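(* Let $X_1,X_2,\ldots$ be i.i.d. random variables with $0\le X_1\le 1$, and let $Y_i=X_i-ic$, $i=1,2,\ldots$, where $c\ge 0$ is the sampling cost per observation. (a) For $0<c\le 1$ fixed and all $n\ge 1$, $$M(Y_1,\ldots,Y_n)-V(Y_1,\ldots,Y_n)\le \begin{cases}[1/c]\,c\,(1-c)^{[1/c]+1}, & \text{for } c\le 1/2,\\ (1-c)/4, & \text{for } c\ge 1/2.\end{cases}$$ (b) For $n\ge 1$ fixed and all $c\ge 0$, $$M(Y_1,\ldots,Y_n)-V(Y_1,\ldots,Y_n)\le (n-1)\left(1-\frac{1}{n+1}\right)^{n}\Big/(n+1).$$ (c) For all $c\ge 0$ and all $n\ge 1$, $$M(Y_1,\ldots,Y_n)-V(Y_1,\ldots,Y_n)<e^{-1}.$$ All bounds are the best possible; that is, the right-hand side cannot be replaced by a smaller constant depending only on $c$ in (a) (valid for all $n\ge 1$ and all such sequences $X_1,X_2,\ldots$), by a smaller constant depending only on $n$ in (b) (valid for all $c\ge 0$ and all such sequences), or by a smaller universal constant in (c) (valid for all $c\ge 0$, all $n\ge 1$ and all such sequences).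
   Context: For any real number $x$, $[x]$ denotes the largest integer strictly smaller than $x$ (so this is not the usual floor function when $x$ is an integer). For $n=1,2,\ldots$, $M(Y_1,\ldots,Y_n)=E(\max_{1\le i\le n}Y_i)$ and $V(Y_1,\ldots,Y_n)=\sup_{\tau\in C^n}E(Y_\tau)$, where $C^n$ denotes the set of all stopping rules for $Y_1,\ldots,Y_n$, i.e. all stopping times $\tau$ with values in $\{1,\ldots,n\}$ with respect to the filtration generated by $Y_1,\ldots,Y_n$. The number $c\ge 0$ is a fixed sampling cost charged for each observation; $M$ and $V$ are interpreted as the expected optimal returns of a prophet and a statistician, respectively. *)

(* Defs.v *)
From HB Require Import structures.
From mathcomp Require Import all_boot all_order all_algebra.
From mathcomp Require Import finmap.
From mathcomp Require Import all_classical all_reals all_analysis.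

Set Implicit Arguments.
Unset Strict Implicit.
Unset Printing Implicit Defensive.

Import Order.TTheory GRing.Theory Num.Theory.
Import numFieldNormedType.Exports.

Local Open Scope classical_set_scope.
Local Open Scope ring_scope.

Definition strict_floor (R : realType) (x : R) : int := Num.ceil x - 1.

Lemma strict_floor_lt (R : realType) (x : R) : (strict_floor x)%:~R < x.
Proof. exact/real_ceilB1_lt/num_real. Qed.

Lemma strict_floor_max (R : realType) (x : R) (m : int) :
  m%:~R < x -> m <= strict_floor x.
Proof.
by move=> mx; rewrite /strict_floor lerBrDr lezD1 real_ceil_gt_int ?num_real.
Qed.

(* All sequences below are indexed from 1: the term of index 0 is an
   unconstrained dummy which no definition looks at. *)

Definition mutually_independent (R : realType) (d : measure_display)
    (T : measurableType d) (P : probability T R)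
    (X : nat -> {RV P >-> R}) : Prop :=
  forall (J : {fset nat}) (A : nat -> set R),
    (forall j, j \in J -> (1 <= j)%N /\ measurable (A j)) ->
    P (\bigcap_(j in [set` J]) (X j @^-1` A j)) =
      (\prod_(j <- J) P (X j @^-1` A j))%E.

Definition identically_distributed (R : realType) (d : measure_display)
    (T : measurableType d) (P : probability T R)
    (X : nat -> {RV P >-> R}) : Prop :=
  forall i (A : set R), (1 <= i)%N -> measurable A ->
    distribution P (X i) A = distribution P (X 1%N) A.

(* The bound on X 1 is almost sure; it passes to all X i through the common
   distribution. *)
Definition iid01 (R : realType) (d : measure_display)
    (T : measurableType d) (P : probability T R)
    (X : nat -> {RV P >-> R}) : Prop :=
  [/\ mutually_independent X, identically_distributed X &
      {ae P, forall w, 0 <= X 1%N w <= 1}].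

Definition net_return (R : realType) (T : Type) (X : nat -> T -> R) (c : R)
    (i : nat) (w : T) : R := X i w - i%:R * c.

(* The sigma-algebra generated by Y 1, ..., Y k. *)
Definition natural_filtration (R : realType) (T : Type) (Y : nat -> T -> R)
    (k : nat) : set (set T) :=
  g_sigma_preimage (fun j : 'I_k => Y j.+1).

Definition stopping_rule (R : realType) (T : Type) (Y : nat -> T -> R)
    (n : nat) (tau : T -> nat) : Prop :=
  (forall w, 1 <= tau w <= n)%N /\
  (forall k, (1 <= k <= n)%N ->
     natural_filtration Y k [set w | (tau w <= k)%N]).

(* The neutral element Y 1 w of the iterated maximum is itself one of the
   values as soon as 1 <= n. *)
Definition prophet_value (R : realType) (d : measure_display)
    (T : measurableType d) (P : probability T R) (Y : nat -> T -> R)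
    (n : nat) : \bar R :=
  ('E_P[fun w => \big[Num.max/Y 1%N w]_(1 <= i < n.+1) Y i w])%E.

Definition statistician_value (R : realType) (d : measure_display)
    (T : measurableType d) (P : probability T R) (Y : nat -> T -> R)
    (n : nat) : \bar R :=
  ereal_sup [set ('E_P[fun w => Y (tau w) w])%E | tau in stopping_rule Y n].

Definition regret (R : realType) (d : measure_display)
    (T : measurableType d) (P : probability T R) (X : nat -> {RV P >-> R})
    (c : R) (n : nat) : \bar R :=
  (prophet_value P (net_return X c) n
   - statistician_value P (net_return X c) n)%E.

(* b bounds the regret for cost c and horizon n, over all probability spaces
   and all admissible sequences on them. *)
Definition regret_bound (R : realType) (c : R) (n : nat) (b : R) : Prop :=
  forall (d : measure_display) (T : measurableType d) (P : probability T R)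
    (X : nat -> {RV P >-> R}),
    iid01 X -> (regret X c n <= b%:E)%E.

(* Main.v *)
Require Import Defs.
From HB Require Import structures.
From mathcomp Require Import all_boot all_order all_algebra.
From mathcomp Require Import finmap ring lra.
From mathcomp Require Import all_classical all_reals all_analysis measurable_realfun.

Set Implicit Arguments.
Unset Strict Implicit.
Unset Printing Implicit Defensive.

Import Order.TTheory GRing.Theory Num.Theory.
Import numFieldNormedType.Exports.

Local Open Scope classical_set_scope.
Local Open Scope ring_scope.

(**
Write q = 1 - p throughout.  Let v_0 = 0 and v_(k+1) = E max(X, v_k) - c.

Upper bounds.  Stopping at i < n as soon as X_i >= v_(n-i) earns v_n, so the
statistician's value is at least v_n.  For the prophet, fix a level a in [0, 1]
and replace every (X_i - a)^+ by a lottery on {0, 1 - a} with the same mean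
p (1 - a); by convexity of the maximum this only helps, and the prophet gets at
most a - c + sum_(0 <= j < n) p q^j (1 - a - jc)^+.
If E X < c, take a = 0: then v_n = E X - c and the difference is at most
sum_(1 <= j < n) p q^j (1 - jc)^+ with p < c.
If E X >= c, take a = v_(n-1): then v_n = a + p (1 - a) - c, and since the
increments of v decrease at least by a factor q, p a >= (p - c)(1 - q^(n-1)).
The resulting bound is a convex combination of the cases of cost p and of cost
0, and is at most (m - 1) p q^m for some m <= n, with p >= c.  It remains to
maximise these expressions over p and m.

Sharpness.  For i.i.d. Bernoulli(p) variables with p <= c no rule beats p - c, as
X_tau - tau c <= sum_(i <= tau) (X_i - c), whereas the prophet gains
sum_(1 <= j < n) p q^j (1 - jc) more; for p = c this is (n - 1) c (1 - c)^n.
Such variables are obtained on [0, 1[ by iterating a piecewise affine map.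
*)

(** * Extremal estimates *)

(** Convexity of the power: this is its tangent at [x], multiplied by [x] to avoid the exponent
    [k - 1]. Each induction step loses exactly [x ^+ k * (k * (y - x) ^+ 2)]. *)
Lemma expr_tangent (R : realFieldType) (x y : R) (k : nat) :
  0 <= x -> 0 <= y -> x ^+ k * (x + k%:R * (y - x)) <= y ^+ k * x.
Proof.
move=> x0 y0; elim: k => [|k IH]; first by rewrite !expr0 mul0r addr0.
have := ler_wpM2l y0 IH.
rewrite (_ : y * (y ^+ k * x) = y ^+ k.+1 * x); last by rewrite exprS mulrA.
apply: le_trans.
rewrite exprS -subr_ge0 -natr1.
have -> : y * (x ^+ k * (x + k%:R * (y - x)))
    - x * x ^+ k * (x + (k%:R + 1) * (y - x)) = x ^+ k * (k%:R * (y - x) ^+ 2).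
  by ring.
by rewrite mulr_ge0 ?exprn_ge0// mulr_ge0// sqr_ge0.
Qed.

(** As a function of [p], the left side is unimodal with peak [1 / (k + 2)]; the sign hypothesis
    says that [r] lies between [p] and this peak. *)
Lemma geo_weight_le (R : realFieldType) (p r : R) (k : nat) :
  0 <= p <= 1 -> 0 <= r <= 1 -> (p - r) * (1 - k.+2%:R * r) <= 0 ->
  p * (1 - p) ^+ k.+1 <= r * (1 - r) ^+ k.+1.
Proof.
move=> /andP[p0 p1] /andP[r0 r1] pr.
have [->|q0] := eqVneq p 1.
  by rewrite subrr expr0n/= mulr0 mulr_ge0// exprn_ge0// subr_ge0.
have {}q0 : 0 < 1 - p by rewrite subr_gt0 lt_neqAle q0.
have q1 : 0 <= 1 - r by rewrite subr_ge0.
have := ler_wpM2l r0 (expr_tangent k.+1 (ltW q0) q1).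
rewrite mulrA [leRHS]mulrA => H.
rewrite -(ler_pM2r q0); apply: le_trans H.
rewrite -[leLHS]mulrA [p * _]mulrCA [r * _]mulrC -[leRHS]mulrA.
apply: ler_wpM2l; first by rewrite exprn_ge0// ltW.
rewrite -subr_ge0.
have -> : r * (1 - p + k.+1%:R * (1 - r - (1 - p))) - p * (1 - p) =
   (p - r) ^+ 2 - (p - r) * (1 - k.+2%:R * r).
  by rewrite -[k.+2]addn2 -[k.+1]addn1 !natrD; ring.
by rewrite subr_ge0 (le_trans pr)// sqr_ge0.
Qed.

(** Telescoping: the summand is [j * (1 - p) ^+ j.+1 - (j - 1) * (1 - p) ^+ j]. *)
Lemma sum_geo_weight (R : realFieldType) (p : R) (n : nat) :
  \sum_(1 <= j < n.+1) (1 - p) ^+ j * (1 - j%:R * p) =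
  n%:R * (1 - p) ^+ n.+1.
Proof.
elim: n => [|n IH]; first by rewrite big_geq// mul0r.
by rewrite big_nat_recr//= IH -!natr1 !exprS; ring.
Qed.

(** Nonpositive terms are dropped from the end, which only weakens the hypothesis on [a]. Once the
    last term is positive, all maxima equal their second argument, and the sum is bounded by [c]
    times the telescoping sum of cost [p] plus [p - c] times a constant sum. *)
Lemma truncated_geo_sum_le (R : realFieldType) (p a c : R) (n : nat) :
  0 <= c <= p -> p <= 1 -> (p - c) * (1 - (1 - p) ^+ n) <= p * a ->
  exists2 N : nat, (N <= n)%N &
    \sum_(1 <= j < n.+1) p * (1 - p) ^+ j * Num.max 0 (1 - a - j%:R * c)
      <= N%:R * p * (1 - p) ^+ N.+1.
Proof.
move=> /andP[c0 cp] p1.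
have q0 : 0 <= 1 - p by rewrite subr_ge0.
have q1 : 1 - p <= 1 by rewrite lerBlDr lerDl (le_trans c0).
elim: n => [|n IH] pa.
  by exists 0%N => //; rewrite big_geq// !mul0r.
have [neg|pos] := leP (1 - a - n.+1%:R * c) 0.
  have [|N Nn H] := IH.
    apply: le_trans pa; rewrite ler_wpM2l ?subr_ge0//.
    by rewrite lerB// ler_wiXn2l.
  exists N; first exact: leqW.
  by rewrite big_nat_recr//= max_l// mulr0 addr0.
exists n.+1 => //.
apply: (@le_trans _ _ (\sum_(1 <= j < n.+2)
   (c * ((1 - p) ^+ j * (1 - j%:R * p)) + (p - c) * (1 - p) ^+ n.+2))).
  apply: ler_sum_nat => j /andP[j1 jn].
  rewrite max_r; last first.
    apply: ltW; apply: lt_le_trans pos _.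
    by rewrite lerD2l lerN2 ler_wpM2r// ler_nat.
  (* The left side equals [c * (1 - j * p) + (p - c) - p * a], and the hypothesis bounds
     [(p - c) - p * a] by [(p - c) * (1 - p) ^+ n.+1]. *)
  have H : p * (1 - a - j%:R * c) <=
      c * (1 - j%:R * p) + (p - c) * (1 - p) ^+ n.+1 by lra.
  rewrite [p * _]mulrC -mulrA.
  apply: (le_trans (ler_wpM2l (exprn_ge0 j q0) H)).
  rewrite mulrDr mulrCA lerD2l mulrCA ler_wpM2l ?subr_ge0//.
  by rewrite [leRHS]exprS ler_wpM2r ?exprn_ge0// -[leRHS]expr1 ler_wiXn2l.
rewrite big_split/= -big_distrr/= sum_geo_weight sumr_const_nat subn1/=.
rewrite -mulr_natl le_eqVlt; apply/orP; left; apply/eqP; ring.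
Qed.

(** The peak over [p] of [N * p * (1 - p) ^+ N.+1], attained at [1 / (N + 2)]; [N = n - 1] gives the
    bound of (b). *)
Definition prophet_const (R : realFieldType) (N : nat) : R :=
  N%:R * N.+2%:R^-1 * (1 - N.+2%:R^-1) ^+ N.+1.

Lemma prophet_constE (R : realFieldType) (n : nat) : (1 <= n)%N ->
  prophet_const R n.-1 =
  (n%:R - 1) * (1 - 1 / (n%:R + 1)) ^+ n / (n%:R + 1).
Proof.
case: n => // n _; rewrite /prophet_const /= !div1r -!natr1 addrK; ring.
Qed.

Lemma natrV_le1 (R : realFieldType) (k : nat) : 0 <= (k.+1%:R^-1 : R) <= 1.
Proof. by rewrite invr_ge0 ler0n invf_le1 ?ltr0n// ler1n. Qed.

Lemma geo_peak_le (R : realFieldType) (p : R) (N : nat) : 0 <= p <= 1 ->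
  N%:R * p * (1 - p) ^+ N.+1 <= prophet_const R N.
Proof.
move=> p01; rewrite /prophet_const -!mulrA ler_wpM2l// geo_weight_le//.
  exact: natrV_le1.
by rewrite divff ?pnatr_eq0// subrr mulr0.
Qed.

Lemma geo_peak_step (R : realFieldType) (N : nat) :
  N%:R <= N.+1%:R * (1 - N.+2%:R^-1 : R).
Proof.
rewrite mulrBr mulr1 -[N.+1]addn1 natrD lerBrDr lerD2l.
by rewrite ler_pdivrMr ?ltr0n// mul1r -natrD ler_nat addn1.
Qed.

(** With [p = 1 / (N + 2)] kept fixed, passing from [N] to [N + 1] already gains, since
    [N <= (N + 1) * (1 - p)]. This serves both the monotonicity of [prophet_const] and the
    optimisation under [c <= p]. *)
Lemma prophet_const_step (R : realFieldType) (N : nat) :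
  prophet_const R N <= N.+1%:R * N.+2%:R^-1 * (1 - N.+2%:R^-1) ^+ N.+2.
Proof.
rewrite /prophet_const [in leRHS]exprS mulrA ler_wpM2r//.
  by rewrite exprn_ge0// subr_ge0; case/andP: (natrV_le1 R N.+1).
rewrite mulrAC ler_wpM2r ?invr_ge0//; exact: geo_peak_step.
Qed.

Lemma prophet_const_homo (R : realFieldType) :
  {homo prophet_const R : m n / (m <= n)%N >-> m <= n}.
Proof.
apply: homo_leq => //; first exact: le_trans.
move=> N; apply: le_trans (prophet_const_step R N) _.
exact/geo_peak_le/natrV_le1.
Qed.

(** Passing from [M] to [M + 1] does not lower the expression while [(M + 1) * c <= 1], and does not
    raise it once [1 <= (M + 1) * c]; hence it is largest at [K]. *)
Lemma linear_geo_le (R : realFieldType) (c : R) (K N : nat) :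
  c <= 1 -> K%:R * c <= 1 -> 1 <= K.+1%:R * c ->
  N%:R * (1 - c) ^+ N.+1 <= K%:R * (1 - c) ^+ K.+1.
Proof.
move=> c1 Kc KSc.
have c0 : 0 <= c.
  by rewrite leNgt; apply/negP => c0; have := pmulr_rlt0 c (ltr0Sn R K); lra.
have up M : M.+1%:R * c <= 1 ->
    M%:R * (1 - c) ^+ M.+1 <= M.+1%:R * (1 - c) ^+ M.+2.
  move=> Mc; rewrite [in leRHS]exprS mulrA ler_wpM2r ?exprn_ge0 ?subr_ge0//.
  by rewrite mulrBr mulr1 -natr1; rewrite -natr1 in Mc; lra.
have down M : 1 <= M.+1%:R * c ->
    M.+1%:R * (1 - c) ^+ M.+2 <= M%:R * (1 - c) ^+ M.+1.
  move=> Mc; rewrite [in leLHS]exprS mulrA ler_wpM2r ?exprn_ge0 ?subr_ge0//.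
  by rewrite mulrBr mulr1 -natr1; rewrite -natr1 in Mc; lra.
case: (leqP N K) => [NK|/ltnW KN].
  rewrite -(subnKC NK); have : (N + (K - N) <= K)%N by rewrite subnKC.
  elim: (K - N)%N => [|d IH] dK; first by rewrite addn0.
  rewrite (le_trans (IH _))//; first by rewrite (leq_trans _ dK)// leq_add2l.
  rewrite addnS up// (le_trans _ Kc)// ler_wpM2r// ler_nat.
  by rewrite -addnS.
rewrite -(subnKC KN); elim: (N - K)%N => [|d IH]; first by rewrite addn0.
rewrite (le_trans _ IH)// addnS down// (le_trans KSc)// ler_wpM2r// ler_nat.
by rewrite ltnS leq_addr.
Qed.

(** If [1 <= (N + 2) * c], the peak in [p] is not to the right of [c], so [p = c] is best and
    [linear_geo_le] optimises [N]. Otherwise the peak [1 / (N + 2)] is admissible, and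
    [prophet_const_step] moves on to [N + 1]; this occurs only for [N < K], hence the induction on
    [K - N]. *)
Lemma geo_peak_le_cost (R : realFieldType) (c : R) (K : nat) :
  c <= 1 -> K%:R * c <= 1 -> 1 <= K.+1%:R * c ->
  forall (N : nat) (p : R), c <= p <= 1 ->
  N%:R * p * (1 - p) ^+ N.+1 <= K%:R * c * (1 - c) ^+ K.+1.
Proof.
move=> c1 Kc KSc.
have c0 : 0 <= c.
  by rewrite leNgt; apply/negP => c0; have := pmulr_rlt0 c (ltr0Sn R K); lra.
have direct N p : c <= p <= 1 -> 1 <= N.+2%:R * c ->
    N%:R * p * (1 - p) ^+ N.+1 <= K%:R * c * (1 - c) ^+ K.+1.
  move=> /andP[cp p1] Nc.
  apply: (@le_trans _ _ (N%:R * (c * (1 - c) ^+ N.+1))).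
    rewrite -mulrA ler_wpM2l// geo_weight_le ?c0 ?p1 ?(le_trans c0)//.
    by rewrite mulr_ge0_le0 ?subr_ge0// subr_le0.
  by rewrite mulrCA [K%:R * c]mulrC -[leRHS]mulrA ler_wpM2l// linear_geo_le.
move=> N; have [d] := ubnP (K - N)%N; elim: d N => // d IH N dN p pc.
have [Nc|Nc] := leP 1 (N.+2%:R * c); first exact: direct.
have NK : (N < K)%N.
  rewrite ltnNge; apply/negP => KN.
  have : (K.+1%:R * c <= N.+2%:R * c) by rewrite ler_wpM2r// ler_nat !ltnS leqW.
  lra.
have p01 : 0 <= p <= 1 by case/andP: pc => ? ->; rewrite (le_trans c0).
apply: (le_trans (geo_peak_le N p01)).
apply: (le_trans (prophet_const_step R N)); apply: IH.
  by rewrite subnS -ltnS prednK ?subn_gt0.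
have cN : c <= N.+2%:R^-1.
  by rewrite -[leRHS]mul1r ler_pdivlMr ?ltr0n// mulrC ltW.
by rewrite cN; case/andP: (natrV_le1 R N.+1).
Qed.

Lemma max0_sum_trunc (R : realFieldType) (p c : R) (n : nat) : 0 <= c ->
  exists2 N : nat, (N <= n)%N /\ N%:R * c <= 1 &
    \sum_(1 <= j < n.+1) p * (1 - p) ^+ j * Num.max 0 (1 - j%:R * c) =
    \sum_(1 <= j < N.+1) p * (1 - p) ^+ j * (1 - j%:R * c).
Proof.
move=> c0; elim: n => [|n [N [Nn Nc] IH]].
  by exists 0%N; [rewrite mul0r; split | rewrite !big_geq].
have [nc|nc] := leP (n.+1%:R * c) 1.
  exists n.+1 => //; apply: eq_big_nat => j /andP[_ jn].
  by rewrite max_r// subr_ge0 (le_trans _ nc)// ler_wpM2r// ler_nat.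
exists N; first by split; [exact: leqW|].
by rewrite big_nat_recr//= IH max_l ?mulr0 ?addr0// subr_le0 ltW.
Qed.

(* The last summand alone need not be monotone in [p] on [0, c], but the sum
   of the last two is: with [t = c - p], the tangent bound on [(1 - p) ^+ k]
   leaves [t * (K * B + K * t - p * (1 - p) * B)] where [K >= p * (1 - p)]. *)
Lemma last_two_le (R : realFieldType) (p c : R) (k : nat) :
  0 <= p <= c -> k.+2%:R * c <= 1 ->
  p * (1 - p) ^+ k.+1 * (1 - k.+1%:R * c) + p * (1 - p) ^+ k.+2 * (1 - k.+2%:R * c)
  <= c * (1 - c) ^+ k.+1 * (1 - k.+1%:R * c) + c * (1 - c) ^+ k.+2 * (1 - k.+2%:R * c).
Proof.
move=> /andP[p0 pc] kc.
have c0 : 0 <= c by lra.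
have c12 : 2 * c <= 1 by rewrite (le_trans _ kc)// ler_wpM2r// ler_nat.
have q0 : 0 < 1 - p by lra.
have r0 : 0 <= 1 - c by lra.
have := expr_tangent k.+1 (ltW q0) r0.
set B := 1 - k.+2%:R * c; have B0 : 0 <= B by rewrite subr_ge0.
have AB : 1 - k.+1%:R * c = B + c by rewrite /B -!natr1; ring.
rewrite AB => tang.
pose K := B + c + B * (1 - c).
have K0 : 0 <= K by rewrite /K; nra.
have cK : c <= K by rewrite /K; nra.
have -> : c * (1 - c) ^+ k.+1 * (B + c) + c * (1 - c) ^+ k.+2 * B =
  (1 - c) ^+ k.+1 * (c * K) by rewrite [in (1 - c) ^+ k.+2]exprS /K; ring.
have -> : p * (1 - p) ^+ k.+1 * (B + c) + p * (1 - p) ^+ k.+2 * B =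
  (1 - p) ^+ k.+1 * (p * (B + c + B * (1 - p))).
  by rewrite [in (1 - p) ^+ k.+2]exprS; ring.
rewrite -(ler_pM2r q0).
have cK0 : 0 <= c * K by rewrite mulr_ge0.
have := ler_wpM2r cK0 tang.
rewrite [X in _ <= X](_ : _ = (1 - c) ^+ k.+1 * (c * K) * (1 - p)); last by ring.
apply: le_trans.
rewrite -!mulrA ler_wpM2l ?exprn_ge0// ?(ltW q0)//.
have kBc : k.+1%:R * c = 1 - B - c by move: AB; lra.
have -> : (1 - p + k.+1%:R * (1 - c - (1 - p))) * (c * K) =
  (c * (1 - p) - (k.+1%:R * c) * (c - p)) * K by ring.
rewrite kBc -subr_ge0.
have -> : (c * (1 - p) - (1 - B - c) * (c - p)) * K
   - p * ((B + c + B * (1 - p)) * (1 - p)) =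
   (c - p) * (K * (B + (c - p)) - p * (1 - p) * B) by rewrite /K; ring.
rewrite mulr_ge0 ?subr_ge0// [K * _]mulrDr.
have pqK : p * (1 - p) <= K by nra.
have := ler_wpM2r B0 pqK.
have : 0 <= K * (c - p) by rewrite mulr_ge0 ?subr_ge0.
lra.
Qed.

(** The right side is the same sum at [p = c]. Since [p * (1 - p) ^+ j] increases up to
    [1 / (j + 1)], terms with [(j + 1) * c <= 1] compare separately; only the last may fail, so it
    is paired with its predecessor. *)
Lemma truncated_sum_mono (R : realFieldType) (p c : R) (N : nat) :
  0 <= p <= c -> c <= 1 / 2 -> N%:R * c <= 1 ->
  \sum_(1 <= j < N.+1) p * (1 - p) ^+ j * (1 - j%:R * c) <=
  N%:R * c * (1 - c) ^+ N.+1.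
Proof.
move=> /andP[p0 pc] c12 Nc.
have c0 : 0 <= c by lra.
have -> : N%:R * c * (1 - c) ^+ N.+1 =
    \sum_(1 <= j < N.+1) c * (1 - c) ^+ j * (1 - j%:R * c).
  under eq_bigr do rewrite -mulrA.
  by rewrite -big_distrr/= sum_geo_weight mulrCA mulrA.
have term j : j.+2%:R * c <= 1 ->
    p * (1 - p) ^+ j.+1 * (1 - j.+1%:R * c) <= c * (1 - c) ^+ j.+1 * (1 - j.+1%:R * c).
  move=> jc; rewrite ler_wpM2r//.
    by rewrite subr_ge0 (le_trans _ jc)// ler_wpM2r// ler_nat.
  rewrite geo_weight_le// ?c0/= ?p0/=; [lra|lra|].
  by rewrite mulr_le0_ge0 ?subr_ge0// subr_le0.
case: N Nc => [|[|N]] Nc; first by rewrite !big_geq.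
  (* For [N = 1] there is no predecessor; [c <= 1 / 2] makes the single term monotone. *)
  by rewrite !big_nat1; apply: term; lra.
rewrite !(@big_nat_recr _ _ _ N.+2)//= !(@big_nat_recr _ _ _ N.+1)//= -!addrA.
rewrite lerD// ?last_two_le ?p0//.
apply: ler_sum_nat => -[|j] // /andP[_ jN]; apply: term.
by rewrite (le_trans _ Nc)// ler_wpM2r// ler_nat ltnS ltnW.
Qed.

(** With [q = 1 - p <= 1 / 2], a factor [N * q ^+ N.-1 <= 1] splits off, leaving [p * q * q] with
    [p * q <= 1 / 4] and [q <= 1 - c]. *)
Lemma half_cost_peak (R : realFieldType) (p c : R) (N : nat) :
  1 / 2 <= c -> c <= p <= 1 -> N%:R * p * (1 - p) ^+ N.+1 <= (1 - c) / 4.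
Proof.
move=> c12 /andP[cp p1]; case: N => [|N]; first by rewrite !mul0r; lra.
have q0 : 0 <= 1 - p by lra.
have H : N.+1%:R * (1 - p) ^+ N <= 1.
  elim: N => [|N IH]; first by rewrite expr0 mulr1.
  have h : N.+2%:R <= 2 * N.+1%:R :> R.
    by rewrite -natrM ler_nat mul2n -addnn addnS ltnS leq_addr.
  have e0 : 0 <= (1 - p) ^+ N by rewrite exprn_ge0.
  rewrite exprS mulrA; apply: le_trans IH; rewrite ler_wpM2r//.
  have : 0 <= N.+1%:R :> R by [].
  nra.
have e0 : 0 <= N.+1%:R * (1 - p) ^+ N by rewrite mulr_ge0// exprn_ge0.
rewrite 2!exprS.
have -> : N.+1%:R * p * ((1 - p) * ((1 - p) * (1 - p) ^+ N)) =
  (N.+1%:R * (1 - p) ^+ N) * (p * (1 - p) * (1 - p)) by ring.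
have w0 : 0 <= p * (1 - p) * (1 - p) by rewrite !mulr_ge0//; lra.
apply: (le_trans (ler_piMl w0 H)).
have : p * (1 - p) <= 1 / 4 by nra.
nra.
Qed.

(** Terms with [j >= 2] vanish because [2 * c >= 1]; the first one is handled by
    [p * (1 - p) <= 1 / 4]. *)
Lemma half_cost_sum (R : realFieldType) (p c : R) (n : nat) :
  1 / 2 <= c <= 1 -> 0 <= p <= 1 ->
  \sum_(1 <= j < n.+1) p * (1 - p) ^+ j * Num.max 0 (1 - j%:R * c) <= (1 - c) / 4.
Proof.
move=> /andP[c12 c1] /andP[p0 p1]; case: n => [|n].
  by rewrite big_geq//; lra.
rewrite big_nat_recl// big1_seq ?addr0; last first.
  move=> j; rewrite mem_index_iota => /andP[_ /andP[j1 _]].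
  rewrite max_l ?mulr0//.
  have : 2 * c <= j.+1%:R * c by apply: ler_wpM2r; [lra|rewrite ler_nat].
  lra.
rewrite expr1 mul1r max_r; last lra.
have pq : p * (1 - p) <= 1 / 4 by have := sqr_ge0 (p - 1 / 2); rewrite expr2; lra.
have r0 : 0 <= 1 - c by lra.
by have := ler_wpM2r r0 pq; lra.
Qed.

(** * Comparison of the constants of (b) with [1 / e] *)

Lemma oneB_natrV (R : realFieldType) (k : nat) :
  1 - k.+1%:R^-1 = k%:R / k.+1%:R :> R.
Proof.
by rewrite -[k%:R](addrK 1) natr1 mulrBl mul1r divff ?pnatr_eq0.
Qed.

(** Replacing [N / (N + 2)] by [(N + 1) / (N + 2)] is a strict increase and yields
    [(1 - 1 / (N + 2)) ^+ N.+2], which [1 + x <= expR x] bounds by [1 / e]. *)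
Lemma prophet_const_lt_expRN1 (R : realType) (N : nat) :
  prophet_const R N < expR (-1).
Proof.
rewrite /prophet_const.
have n0 : 0 < N.+2%:R :> R by rewrite ltr0n.
have n1 : 0 < N.+1%:R :> R by rewrite ltr0n.
have qE := oneB_natrV R N.+1.
have H : (1 - N.+2%:R^-1) ^+ N.+2 <= expR (-1) :> R.
  have -> : -1 = N.+2%:R * (- N.+2%:R^-1) :> R by rewrite mulrN divff// gt_eqF.
  rewrite expRM_natl lerXn2r ?nnegrE ?expR_ge0//.
    by rewrite qE divr_ge0.
  by rewrite expR_ge1Dx.
apply: (@lt_le_trans _ _ ((1 - N.+2%:R^-1) ^+ N.+2)) => //.
rewrite [ltRHS]exprS ltr_pM2r; last by rewrite exprn_gt0// qE divr_gt0.
by rewrite qE ltr_pM2r ?invr_gt0// ltr_nat.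
Qed.

Lemma expRN1_le_of_prophet_const (R : realType) (b : R) :
  (forall N, prophet_const R N <= b) -> expR (-1) <= b.
Proof.
move=> H.
(* [prophet_const R N] is [N / (N + 1)] times [(1 - 1 / (N + 2)) ^+ N.+2]. Two uses of
   [1 + x <= expR x], at [x = 1 / (N + 1)] and at its opposite, bound the power below by
   [expR (-1) * (1 - 1 / (N + 1))]; the two factors [1 - 1 / (N + 1)] multiply to at least
   [1 - 2 / (N + 1)]. *)
have low (N : nat) : expR (-1) * (1 - 2 / N.+1%:R) <= b.
  apply: le_trans (H N); rewrite /prophet_const.
  have n0 : 0 < N.+2%:R :> R by rewrite ltr0n.
  have n1 : 0 < N.+1%:R :> R by rewrite ltr0n.
  have n2 : 0 <= N%:R :> R by rewrite ler0n.
  have qE := oneB_natrV R N.+1.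
  have e1 : expR (- N.+1%:R^-1) <= 1 - N.+2%:R^-1 :> R.
    rewrite expRN qE -[N.+1%:R / _]invf_div lef_pV2 ?posrE ?expR_gt0 ?divr_gt0//.
    apply: le_trans (expR_ge1Dx _).
    by rewrite -[N.+2%:R]natr1 mulrDl mul1r divff ?gt_eqF.
  have e2 : expR (-1) * (1 - N.+1%:R^-1) <= (1 - N.+2%:R^-1) ^+ N.+2 :> R.
    apply: (@le_trans _ _ (expR (- N.+1%:R^-1) ^+ N.+2)).
      rewrite -expRM_natl.
      have -> : N.+2%:R * - N.+1%:R^-1 = - 1 + - N.+1%:R^-1 :> R.
        by rewrite -[N.+2%:R]natr1; field; rewrite gt_eqF.
      by rewrite expRD ler_wpM2l ?expR_ge0// expR_ge1Dx.
    by rewrite lerXn2r ?nnegrE ?expR_ge0// qE divr_ge0 ?ltW.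
  have -> : N%:R / N.+2%:R * (1 - N.+2%:R^-1) ^+ N.+1 =
      (N%:R / N.+1%:R) * (1 - N.+2%:R^-1) ^+ N.+2 :> R.
    rewrite [in RHS]exprS mulrA; congr (_ * _); rewrite qE.
    by field; rewrite !gt_eqF.
  have nE := esym (oneB_natrV R N).
  have u1 : 0 <= N%:R / N.+1%:R :> R by rewrite divr_ge0.
  apply: le_trans (ler_wpM2l u1 e2).
  rewrite mulrCA ler_wpM2l ?expR_ge0// nE.
  by move: (N.+1%:R^-1 : R) => x; have := sqr_ge0 x; rewrite expr2; lra.
apply/ler_addgt0Pr => e e0.
have e1 : 0 < expR (-1) :> R by exact: expR_gt0.
pose N := Num.truncn (2 * expR (-1) / e).
have hN : 2 * expR (-1) / e < N.+1%:R by exact: truncnS_gt.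
have := low N; rewrite mulrBr mulr1 lerBlDr => /le_trans; apply.
rewrite lerD2l mulrCA mulrA ler_pdivrMr ?ltr0n// [e * _]mulrC.
by rewrite -ler_pdivrMr// ltW.
Qed.

(** * Expectations of products of independent variables *)

Section bounded_expectation.
Context d (T : measurableType d) (R : realType) (P : probability T R).
Implicit Types f g G : T -> R.

Definition bmfun f := measurable_fun setT f /\ exists K, forall w, `|f w| <= K.

Lemma bmfun_integrable f : bmfun f -> P.-integrable setT (EFin \o f).
Proof.
move=> [mf [K fK]]; apply: measurable_bounded_integrable => //.
  by rewrite (le_lt_trans (probability_le1 _ _))// ltry.
exists K; split; first exact: num_real.
by move=> x Kx w _ /=; rewrite (le_trans (fK w))// ltW.
Qed.

Lemma bmfun_cst (r : R) : bmfun (fun _ => r).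
Proof. by split => //; exists `|r|. Qed.

Lemma bmfunD f g : bmfun f -> bmfun g -> bmfun (fun w => f w + g w).
Proof.
move=> [mf [K fK]] [mg [L gL]]; split; first exact: measurable_funD.
by exists (K + L) => w; rewrite (le_trans (ler_normD _ _))// lerD.
Qed.

Lemma bmfunM f g : bmfun f -> bmfun g -> bmfun (fun w => f w * g w).
Proof.
move=> [mf [K fK]] [mg [L gL]]; split; first exact: measurable_funM.
by exists (K * L) => w; rewrite normrM ler_pM.
Qed.

Lemma bmfunZ (r : R) f : bmfun f -> bmfun (fun w => r * f w).
Proof. by move=> bf; apply: bmfunM => //; exact: bmfun_cst. Qed.

Lemma bmfunN f : bmfun f -> bmfun (fun w => - f w).
Proof.
by move=> /(bmfunZ (-1)); under eq_fun do rewrite mulN1r.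
Qed.

Lemma bmfunB f g : bmfun f -> bmfun g -> bmfun (fun w => f w - g w).
Proof. by move=> bf bg; apply: bmfunD => //; exact: bmfunN. Qed.

Lemma bmfun_max f g : bmfun f -> bmfun g -> bmfun (fun w => Num.max (f w) (g w)).
Proof.
move=> [mf [K fK]] [mg [L gL]]; split; first exact: measurable_maxr.
exists (Num.max K L) => w.
by case: (leP (f w) (g w)) => _; rewrite le_max ?fK ?gL ?orbT.
Qed.

(** For the unclipped returns, which are bounded only almost surely. *)
Lemma measurable_bigmax (I : Type) (s : seq I) f (h : I -> T -> R) :
  measurable_fun setT f -> (forall i, measurable_fun setT (h i)) ->
  measurable_fun setT (fun w => \big[Num.max/f w]_(i <- s) h i w).
Proof.
move=> mf mh; elim: s => [|i s IH].
  by under eq_fun do rewrite big_nil.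
by under eq_fun do rewrite big_cons; exact: measurable_maxr.
Qed.

Lemma bmfun_bigmax (I : Type) (s : seq I) f (h : I -> T -> R) :
  bmfun f -> (forall i, bmfun (h i)) ->
  bmfun (fun w => \big[Num.max/f w]_(i <- s) h i w).
Proof.
move=> bf bh; elim: s => [|i s IH].
  by under eq_fun do rewrite big_nil.
by under eq_fun do rewrite big_cons; exact: bmfun_max.
Qed.

Lemma bmfun_sum (I : Type) (s : seq I) (h : I -> T -> R) :
  (forall i, bmfun (h i)) -> bmfun (fun w => \sum_(i <- s) h i w).
Proof.
move=> bh; elim: s => [|i s IH].
  by under eq_fun do rewrite big_nil; exact: bmfun_cst.
by under eq_fun do rewrite big_cons; exact: bmfunD.
Qed.

Lemma bmfun_prod (I : Type) (s : seq I) (Q : pred I) (h : I -> T -> R) :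
  (forall i, bmfun (h i)) -> bmfun (fun w => \prod_(i <- s | Q i) h i w).
Proof.
move=> bh; elim: s => [|i s IH].
  by under eq_fun do rewrite big_nil; exact: bmfun_cst.
under eq_fun do rewrite big_cons; case: (Q i) => //; exact: bmfunM.
Qed.

Lemma expect_cst (r : R) : \int[P]_w r = r.
Proof. by rewrite Rintegral_cst//= probability_setT mulr1. Qed.

Lemma expectD f g : bmfun f -> bmfun g ->
  \int[P]_w (f w + g w) = \int[P]_w f w + \int[P]_w g w.
Proof. by move=> bf bg; rewrite RintegralD//; exact: bmfun_integrable. Qed.

Lemma expectB f g : bmfun f -> bmfun g ->
  \int[P]_w (f w - g w) = \int[P]_w f w - \int[P]_w g w.
Proof. by move=> bf bg; rewrite RintegralB//; exact: bmfun_integrable. Qed.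

Lemma expectZ (r : R) f : bmfun f -> \int[P]_w (r * f w) = r * \int[P]_w f w.
Proof. by move=> bf; rewrite RintegralZl//; exact: bmfun_integrable. Qed.

Lemma expect_onem f : bmfun f -> \int[P]_w (1 - f w) = 1 - \int[P]_w f w.
Proof. by move=> bf; rewrite (expectB (bmfun_cst 1) bf) expect_cst. Qed.

Lemma expect_le f g : bmfun f -> bmfun g -> (forall w, f w <= g w) ->
  \int[P]_w f w <= \int[P]_w g w.
Proof. by move=> bf bg fg; apply: le_Rintegral => //; exact: bmfun_integrable. Qed.

Lemma expect_sum (I : Type) (s : seq I) (h : I -> T -> R) :
  (forall i, bmfun (h i)) ->
  \int[P]_w (\sum_(i <- s) h i w) = \sum_(i <- s) \int[P]_w h i w.
Proof.
move=> bh; elim: s => [|i s IH].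
  by under eq_Rintegral do rewrite big_nil; rewrite expect_cst big_nil.
under eq_Rintegral do rewrite big_cons.
by rewrite expectD// ?big_cons ?IH//; exact: bmfun_sum.
Qed.

Lemma expect_indic (A : set T) : measurable A -> (\int[P]_w \1_A w)%:E = P A.
Proof.
move=> mA; rewrite /Rintegral integral_indic// setIT fineK//.
by rewrite fin_num_measure.
Qed.

Lemma expectationE f : bmfun f -> ('E_P[f] = (\int[P]_w f w)%:E)%E.
Proof.
move=> bf; rewrite unlock /Rintegral fineK//.
by apply: integrable_fin_num => //; exact: bmfun_integrable.
Qed.

End bounded_expectation.

(** * Functions with values in the unit interval and their step approximations *)

Section unit_functions.
Context (R : realType).
Implicit Types (f : R -> R) (y : R).

Definition unitfun f := measurable_fun setT f /\ forall x, 0 <= f x <= 1.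

Lemma unitfun_bmfun d (T : measurableType d) (X : T -> R) f :
  measurable_fun setT X -> unitfun f -> bmfun (fun w => f (X w)).
Proof.
move=> mX [mf f01]; split; first exact: measurableT_comp.
by exists 1 => w; case/andP: (f01 (X w)) => f0 f1; rewrite ger0_norm.
Qed.

Lemma unitfun_indic (A : set R) : measurable A -> unitfun \1_A.
Proof.
move=> mA; split; first exact: measurable_indic.
by move=> x; rewrite indicE; case: (x \in A); rewrite /= ?lexx ler01.
Qed.

Lemma unitfun_onem f : unitfun f -> unitfun (fun x => 1 - f x).
Proof.
move=> [mf f01]; split; first exact: measurable_funB.
by move=> x; have := f01 x; lra.
Qed.

(** The sum counts the integers of [1, N] up to [y], which is the integer part of [y] when [y <= N].
    The first clause feeds the induction. *)
Lemma step_count_le (N : nat) y : 0 <= y ->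
  [/\ N%:R <= y -> \sum_(1 <= i < N.+1) ((i%:R : R) <= y)%R%:R = N%:R :> R,
   \sum_(1 <= i < N.+1) ((i%:R : R) <= y)%R%:R <= y &
   y <= N%:R -> y - 1 <= \sum_(1 <= i < N.+1) ((i%:R : R) <= y)%R%:R].
Proof.
move=> y0; elim: N => [|N [H1 H2 H3]].
  by rewrite big_geq//; split => //; lra.
rewrite big_nat_recr//=; have [yN|yN] /= := leP N.+1%:R y.
  have Ny : N%:R <= y by rewrite (le_trans _ yN)// ler_nat.
  by rewrite H1// natr1; split => //; lra.
rewrite addr0; split => //; move=> _; have [/H3//|Ny] := leP y N%:R.
by rewrite H1 ?ltW//; move: yN; rewrite -natr1; lra.
Qed.

End unit_functions.

(* A function [f] with values in [0, 1] is within [1 / N] of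
   [N^-1 * \sum_(1 <= i <= N) \1_[set x | i <= N * f x]]. *)
Lemma eq_expect_transfer d (T : measurableType d) (R : realType)
    (P : probability T R) (X Y G : T -> R) (C : R) :
  measurable_fun setT X -> measurable_fun setT Y -> bmfun G ->
  (forall w, 0 <= G w <= 1) -> 0 <= C ->
  (forall A : set R, measurable A ->
     \int[P]_w (G w * \1_A (X w)) = C * \int[P]_w \1_A (Y w)) ->
  forall f, unitfun f ->
    \int[P]_w (G w * f (X w)) = C * \int[P]_w f (Y w).
Proof.
move=> mX mY bG G01 C0 indH f uf.
have [mf f01] := uf.
pose A (N i : nat) : set R := [set x | i%:R <= N%:R * f x].
have mA N i : measurable (A N i).
  rewrite [A N i](_ : _ = (fun x => N%:R * f x) @^-1` `[i%:R, +oo[); last first.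
    by apply/seteqP; split => x; rewrite /A/= in_itv/= andbT.
  rewrite -[X in measurable X]setTI.
  by apply: measurable_funM => //; exact: measurable_cst.
pose F (N : nat) x := N%:R^-1 * \sum_(1 <= i < N.+1) (\1_(A N i) x : R).
have FE N x : (0 < N)%N -> F N x <= f x <= F N x + N%:R^-1.
  move=> N0; have NR : 0 < N%:R :> R by rewrite ltr0n.
  have := f01 x => /andP[f0 f1].
  have [_ H2 H3] := step_count_le N (mulr_ge0 (ler0n R N) f0).
  rewrite /F; under eq_bigr do rewrite indicE /A/= mem_setE.
  rewrite -[X in _ <= _ + X]mulr1 -mulrDr.
  rewrite ler_pdivrMl// ler_pdivlMl// H2/= -lerBlDr H3//.
  by rewrite ler_piMr.
have bi N i (Z : T -> R) : measurable_fun setT Z -> bmfun (fun w => \1_(A N i) (Z w) : R).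
  by move=> mZ; apply: unitfun_bmfun => //; exact: unitfun_indic.
have bF N (Z : T -> R) : measurable_fun setT Z -> bmfun (fun w => F N (Z w)).
  by move=> mZ; apply: bmfunZ; apply: bmfun_sum => i; exact: bi.
have FH N : \int[P]_w (G w * F N (X w)) = C * \int[P]_w F N (Y w).
  rewrite /F expectZ; last by apply: bmfun_sum => i; exact: bi.
  rewrite expect_sum; last by move=> i; exact: bi.
  rewrite mulrCA big_distrr/=.
  under [in RHS]eq_bigr do rewrite -indH//.
  rewrite -expect_sum; last by move=> i; apply: bmfunM => //; exact: bi.
  rewrite -expectZ; last by apply: bmfun_sum => i; apply: bmfunM => //; exact: bi.
  by apply: eq_Rintegral => w _; rewrite mulrCA big_distrr.
have bfX := unitfun_bmfun mX uf.
have bfY := unitfun_bmfun mY uf.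
(* Each integral is within [1 / N] of its step version, the second one being scaled by [C], and the
   step versions agree by [FH]. *)
have close N : (0 < N)%N ->
    `|\int[P]_w (G w * f (X w)) - C * \int[P]_w f (Y w)| <= (1 + C) * N%:R^-1.
  move=> N0; have NV : 0 <= N%:R^-1 :> R by rewrite invr_ge0.
  have l1 : \int[P]_w (G w * F N (X w)) <= \int[P]_w (G w * f (X w)).
    apply: expect_le; [exact: bmfunM (bF _ _ _)|exact: bmfunM|].
    move=> w; apply: ler_wpM2l; first by case/andP: (G01 w).
    by case/andP: (FE N (X w) N0).
  have l2 : \int[P]_w (G w * f (X w)) <= \int[P]_w (G w * F N (X w)) + N%:R^-1.
    rewrite -[X in _ + X](expect_cst P) -expectD; last 2 first.
    - exact: bmfunM (bF _ _ _).
    - exact: bmfun_cst.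
    apply: expect_le; [exact: bmfunM|apply: bmfunD|].
    - exact: bmfunM (bF _ _ _).
    - exact: bmfun_cst.
    move=> w; case/andP: (FE N (X w) N0) => _ fF.
    case/andP: (G01 w) => G0 G1.
    apply: (le_trans (ler_wpM2l G0 fF)); rewrite mulrDr lerD2l.
    by rewrite ler_piMl.
  have l3 : \int[P]_w (F N (Y w)) <= \int[P]_w (f (Y w)).
    apply: expect_le => [||w]; [exact: bF|by []|].
    by case/andP: (FE N (Y w) N0).
  have l4 : \int[P]_w (f (Y w)) <= \int[P]_w (F N (Y w)) + N%:R^-1.
    rewrite -[X in _ + X](expect_cst P) -expectD; last 2 first.
    - exact: bF.
    - exact: bmfun_cst.
    apply: expect_le => [||w]; [by []|apply: bmfunD|].
    - exact: bF.
    - exact: bmfun_cst.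
    by case/andP: (FE N (Y w) N0).
  rewrite FH in l1 l2.
  have m3 := ler_wpM2l C0 l3; have m4 := ler_wpM2l C0 l4.
  rewrite ler_norml; apply/andP; split; nra.
apply/eqP; rewrite -subr_eq0 -normr_le0; apply/ler_addgt0Pr => e e0; rewrite add0r.
pose N := Num.truncn ((1 + C) / e).
apply: (le_trans (close N.+1 _)) => //.
rewrite ler_pdivrMr ?ltr0n// mulrC -ler_pdivrMr// ltW//; exact: truncnS_gt.
Qed.

Section independent_products.
Context d (T : measurableType d) (R : realType) (P : probability T R).
Variable X : nat -> {RV P >-> R}.
Hypotheses (indX : mutually_independent X) (idX : identically_distributed X).

Lemma expect_prod_indic (n : nat) (A : nat -> set R) :
  (forall j, measurable (A j)) ->
  \int[P]_w (\prod_(1 <= j < n.+1) \1_(A j) (X j w)) =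
  \prod_(1 <= j < n.+1) \int[P]_w \1_(A j) (X 1%N w) :> R.
Proof.
move=> mA.
have mXA i j : measurable (X i @^-1` A j).
  by rewrite -[X in measurable X]setTI; exact: measurable_funP.
pose J : {fset nat} := [fset j in index_iota 1 n.+1]%fset.
have JE j : (j \in J) = (1 <= j < n.+1)%N by rewrite !inE mem_index_iota.
have JA : forall j, j \in J -> (1 <= j)%N /\ measurable (A j).
  by move=> j; rewrite JE => /andP[].
have H := indX JA.
apply: EFin_inj.
have -> : (fun w => \prod_(1 <= j < n.+1) \1_(A j) (X j w)) =
    \1_(\bigcap_(j in [set` J]) (X j @^-1` A j)) :> (T -> R).
  apply/funext => w; rewrite indicE.
  have [wJ|wJ] := boolP (w \in _).
    rewrite big1_seq// => j /= jn; rewrite indicE mem_set//.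
    by move: wJ; rewrite inE => /(_ j); apply; rewrite /= JE -mem_index_iota.
  apply/eqP; rewrite prodf_seq_eq0; apply: contraNT wJ => /hasPn wJ.
  rewrite inE => j /=; rewrite JE => jn.
  have /wJ /= : j \in index_iota 1 n.+1 by rewrite mem_index_iota.
  by rewrite indicE pnatr_eq0 eqb0 negbK inE.
rewrite expect_indic; last first.
  by apply: fin_bigcap_measurable => // j _; exact: mXA.
rewrite H -prodEFin.
rewrite (perm_big (index_iota 1 n.+1))/=; last first.
  apply: uniq_perm => //; [exact: fset_uniq|exact: iota_uniq|].
  by move=> j; rewrite JE mem_index_iota.
rewrite big_seq [RHS]big_seq; apply: eq_bigr => j; rewrite mem_index_iota => /andP[j1 _].
transitivity (P (X 1%N @^-1` A j)); first exact: idX.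
by rewrite -expect_indic.
Qed.

(* Indicators are replaced by general functions one index at a time. *)
Lemma expect_prod (n : nat) (f : nat -> R -> R) : (forall j, unitfun (f j)) ->
  \int[P]_w (\prod_(1 <= j < n.+1) f j (X j w)) =
  \prod_(1 <= j < n.+1) \int[P]_w f j (X 1%N w).
Proof.
have mX j : measurable_fun setT (X j) by exact: measurable_funP.
(* [k] bounds the indices that may carry arbitrary functions, all later ones carrying indicators:
   [k = 0] is the independence hypothesis and [k = n] the claim. *)
suff H k : (k <= n)%N -> forall g : nat -> R -> R, (forall j, unitfun (g j)) ->
    (forall j, (k < j <= n)%N -> exists2 A : set R, measurable A & g j = \1_A) ->
    \int[P]_w (\prod_(1 <= j < n.+1) g j (X j w)) =
    \prod_(1 <= j < n.+1) \int[P]_w g j (X 1%N w).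
  move=> uf; apply: (H n) => // j /andP[nj jn].
  by move: (leq_trans nj jn); rewrite ltnn.
elim: k => [|k IH] kn g ug gA.
  have /boolp.choice [A AP] j : exists B : set R, measurable B /\
      ((1 <= j <= n)%N -> g j = \1_B).
    have [jn|jn] := boolP (1 <= j <= n)%N.
      by have [A mA ->] := gA j jn; exists A.
    by exists setT; split => //; rewrite (negbTE jn).
  have mA j : measurable (A j) by case: (AP j).
  transitivity (\int[P]_w (\prod_(1 <= j < n.+1) \1_(A j) (X j w)) : R).
    apply: eq_Rintegral => w _; apply: eq_big_nat => j jn.
    by rewrite (proj2 (AP j)).
  rewrite expect_prod_indic//; apply: eq_big_nat => j jn.
  by rewrite (proj2 (AP j)).
have ki : k.+1 \in index_iota 1 n.+1 by rewrite mem_index_iota ltnS.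
have un := iota_uniq 1 (n.+1 - 1).
(* The factors other than the one of index [k + 1] are frozen; agreement on indicators at that index
   is the induction hypothesis. *)
pose G w := \prod_(j <- index_iota 1 n.+1 | j != k.+1) g j (X j w).
pose C := \prod_(j <- index_iota 1 n.+1 | j != k.+1) \int[P]_w g j (X 1%N w).
have bg i j : bmfun (fun w => g j (X i w)) by exact: unitfun_bmfun.
transitivity (\int[P]_w (G w * g k.+1 (X k.+1 w))).
  by apply: eq_Rintegral => w _; rewrite (bigD1_seq k.+1)//= mulrC.
rewrite (bigD1_seq k.+1)//= mulrC -/C.
apply: eq_expect_transfer => //.
- exact: bmfun_prod.
- move=> w; apply/andP; split.
    by apply: prodr_ge0 => j _; case/andP: (proj2 (ug j) (X j w)).
  by apply: prodr_ile1 => j _; exact: (proj2 (ug j) (X j w)).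
- apply: prodr_ge0 => j _; apply: Rintegral_ge0 => w _.
  by case/andP: (proj2 (ug j) (X 1%N w)).
move=> A mA.
pose h j := if j == k.+1 then \1_A else g j.
have := IH (ltnW kn) h; rewrite !(bigD1_seq k.+1)//= /h eqxx => H.
transitivity (\int[P]_w (\prod_(1 <= j < n.+1) h j (X j w))).
  apply: eq_Rintegral => w _; rewrite (bigD1_seq k.+1)//= /h eqxx mulrC.
  by congr (_ * _); apply: eq_bigr => j /negbTE ->.
rewrite H; first last.
- move=> j /andP[kj jn]; have [jk|jk] := eqVneq j k.+1; first by exists A.
  by apply: gA; rewrite jn ltn_neqAle eq_sym jk kj.
- by move=> j; case: ifP => _ //; exact: unitfun_indic.
by rewrite mulrC; congr (_ * _); apply: eq_bigr => j /negbTE ->.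
Qed.

End independent_products.

(** * Bounds on the prophet and on the statistician *)

Section stopping_mixture.
Context (R : realFieldType).
Implicit Types (g r : nat -> R).

(* The payoff of going through the indices [k, k + m) in order, stopping at [i]
   with conditional weight [g i] and then receiving [r i / g i]. *)
Fixpoint stop_mix g r (k m : nat) : R :=
  if m is m'.+1 then r k + (1 - g k) * stop_mix g r k.+1 m' else 0.

Lemma stop_mixE g r k m : stop_mix g r k m =
  \sum_(k <= i < k + m) (\prod_(k <= l < i) (1 - g l)) * r i.
Proof.
elim: m k => [|m IH] k; first by rewrite addn0 big_geq.
rewrite /= IH addnS big_ltn ?ltnS ?leq_addr// big_geq// mul1r addSn.
congr (_ + _); rewrite big_distrr/=; apply: eq_big_nat => i /andP[ki _].
by rewrite mulrA [in RHS]big_ltn.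
Qed.

Lemma stop_mix_cst (p : R) (b : nat -> R) m :
  stop_mix (fun _ => p) (fun i => p * b i) 1 m =
  \sum_(1 <= i < m.+1) p * (1 - p) ^+ i.-1 * b i.
Proof.
rewrite stop_mixE add1n; apply: eq_big_nat => i /andP[i1 _].
by rewrite prodr_const_nat subn1 mulrCA mulrA.
Qed.

(** Zero-one weights stop for certain at the first success. This turns a stopped payoff into sums of
    products, whose expectations independence computes. *)
Lemma stop_mix_find (a : pred nat) (y : nat -> R) k m : has a (iota k m) ->
  stop_mix (fun i => (a i)%:R) (fun i => (a i)%:R * y i) k m =
  y (k + find a (iota k m))%N.
Proof.
elim: m k => [//|m IH] k /=; case ak: (a k) => /= H.
  by rewrite subrr mul0r addr0 mul1r addn0.
by rewrite mul0r add0r subr0 mul1r IH// addnS.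
Qed.

(* Replacing each value [z i <= u i * b i] by a lottery paying [b i] with
   probability [u i] can only increase the maximum, since [b] decreases. *)
Lemma le_stop_mix (u b z : nat -> R) : (forall i, 0 <= u i <= 1) ->
  (forall i, 0 <= b i) -> (forall i, b i.+1 <= b i) ->
  (forall i, z i <= u i * b i) ->
  forall m k i, (k <= i < k + m)%N ->
    z i <= stop_mix u (fun i => u i * b i) k m.
Proof.
move=> u01 b0 bS zub.
(* As [b] decreases, a mixture started at [k] is at most [b k]; hence prepending an index never
   lowers it. *)
have bnd m k : 0 <= stop_mix u (fun i => u i * b i) k m <= b k.
  elim: m k => [|m IH] k /=; first by rewrite lexx b0.
  have /andP[x0 xb] := IH k.+1; have := b0 k; have := bS k.
  by have /andP[u0 u1] := u01 k; move: x0 xb; set x := stop_mix _ _ _ _; nra.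
elim=> [|m IH] k i; first by rewrite addn0 => /andP[/leq_ltn_trans /[apply]]; rewrite ltnn.
rewrite leq_eqVlt => /andP[/predU1P[<- _|ki im]] /=.
  rewrite (le_trans (zub k))// lerDl mulr_ge0 ?subr_ge0//.
    by case/andP: (u01 k).
  by case/andP: (bnd m k.+1).
have zi : z i <= stop_mix u (fun i => u i * b i) k.+1 m.
  by apply: IH; rewrite ki addSn -addnS.
apply: (le_trans zi).
have /andP[x0 xb] := bnd m k.+1; have := bS k.
by have /andP[u0 u1] := u01 k; move: x0 xb; set x := stop_mix _ _ _ _; nra.
Qed.

End stopping_mixture.

(** * Prophet from above and statistician from below, for general sequences *)

Section upper_bound.
Context d (T : measurableType d) (R : realType) (P : probability T R).
Variable X : nat -> {RV P >-> R}.
Hypothesis iidX : iid01 X.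

(* The bounds on the variables hold only almost surely; truncating makes them hold
   everywhere. *)
Definition clip (x : R) : R := Num.max 0 (Num.min 1 x).

Lemma clip01 x : 0 <= clip x <= 1.
Proof. by rewrite /clip le_max lexx/= ge_max ler01 ge_min lexx. Qed.

Lemma clip_id x : 0 <= x <= 1 -> clip x = x.
Proof. by move=> /andP[x0 x1]; rewrite /clip min_r// max_r. Qed.

Lemma unitfun_clip : unitfun clip.
Proof.
split; last exact: clip01.
apply: measurable_maxr; first exact: measurable_cst.
by apply: measurable_minr; [exact: measurable_cst|exact: measurable_id].
Qed.

(** At [a = 1] the quotient is 0 by convention, and the excess over [a] is 0 as well. *)
Lemma excess_mulVK (a x : R) : a <= 1 ->
  Num.max 0 (clip x - a) / (1 - a) * (1 - a) = Num.max 0 (clip x - a).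
Proof.
move=> a1; have [<-|a1'] := eqVneq 1 a; last by rewrite divfK// subr_eq0.
by rewrite subrr mulr0 max_l// subr_le0; case/andP: (clip01 x).
Qed.

Lemma unitfun_excess (a : R) : 0 <= a <= 1 ->
  unitfun (fun x => Num.max 0 (clip x - a) / (1 - a)).
Proof.
move=> /andP[a0 a1]; split.
  apply: measurable_funM; last exact: measurable_cst.
  apply: measurable_maxr; first exact: measurable_cst.
  by apply: measurable_funB; [exact: (proj1 unitfun_clip)|exact: measurable_cst].
move=> x; have /andP[x0 x1] := clip01 x.
have m0 : 0 <= Num.max 0 (clip x - a) by rewrite le_max lexx.
have m1 : Num.max 0 (clip x - a) <= 1 - a.
  by rewrite ge_max subr_ge0 a1/= lerD2r.
rewrite divr_ge0 ?subr_ge0//=.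
have [->|a1'] := eqVneq a 1; first by rewrite subrr invr0 mulr0.
by rewrite ler_pdivrMr ?mul1r// subr_gt0 lt_neqAle a1'.
Qed.

Let mX j : measurable_fun setT (X j). Proof. exact: measurable_funP. Qed.

Lemma ae_clip : {ae P, forall w, forall j, (1 <= j)%N -> clip (X j w) = X j w}.
Proof.
case: iidX => _ idX ae1; apply: ae_foralln => -[|j].
  by apply: aeW.
have mI : measurable (`[0%R, 1%R]%classic : set R) by exact: measurable_itv.
have mC : measurable (~` (`[0%R, 1%R]%classic : set R)) by exact: measurableC.
have mXI i : measurable (X i @^-1` ~` `[0%R, 1%R]%classic).
  by rewrite -[Y in measurable Y]setTI; exact: mX.
have /negligibleP P1 : P.-negligible (X 1%N @^-1` ~` `[0%R, 1%R]%classic).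
  apply: negligibleS ae1 => w /=; apply: contra_not; rewrite in_itv//=.
have : P.-negligible (X j.+1 @^-1` ~` `[0%R, 1%R]%classic).
  apply/negligibleP => //.
  by transitivity (P (X 1%N @^-1` ~` `[0%R, 1%R]%classic)); [exact: idX|exact: P1].
apply: negligibleS => w /= H xI; apply: H => _.
by apply: clip_id; rewrite in_itv in xI.
Qed.

Lemma expectation_ae_eq (f g : T -> R) : measurable_fun setT f ->
  measurable_fun setT g -> {ae P, forall w, f w = g w} -> ('E_P[f] = 'E_P[g])%E.
Proof.
move=> mf mg fg; rewrite unlock; apply: ae_eq_integral => //.
- exact/measurable_EFinP.
- exact/measurable_EFinP.
- by apply: filterS fg => w /= -> _.
Qed.

Lemma bmfun_stop_mix (g r : nat -> T -> R) k m : (forall i, bmfun (g i)) ->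
  (forall i, bmfun (r i)) -> bmfun (fun w => stop_mix (g ^~ w) (r ^~ w) k m).
Proof.
move=> bg br; elim: m k => [|m IH] k /=; first exact: bmfun_cst.
apply: bmfunD => //; apply: bmfunM => //; apply: bmfunB => //; exact: bmfun_cst.
Qed.

(** Each term multiplies a function of [X i] by functions of earlier variables, so expectation
    passes inside. Payoffs are combinations of two unit functions because net returns may be
    negative, while [expect_prod] takes unit functions. *)
Lemma expect_stop_mix (G F H : nat -> R -> R) (al be : nat -> R) (m : nat) :
  (forall i, unitfun (G i)) -> (forall i, unitfun (F i)) ->
  (forall i, unitfun (H i)) ->
  \int[P]_w (stop_mix (fun i => G i (X i w))
    (fun i => al i * F i (X i w) + be i * H i (X i w)) 1 m) =
  stop_mix (fun i => \int[P]_w G i (X 1%N w))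
    (fun i => al i * \int[P]_w F i (X 1%N w)
            + be i * \int[P]_w H i (X 1%N w)) 1 m.
Proof.
case: iidX => indX idX _ uG uF uH.
have bm i (f : R -> R) : unitfun f -> bmfun (fun w => f (X i w)).
  by move=> uf; apply: unitfun_bmfun.
rewrite stop_mixE; under eq_Rintegral do rewrite stop_mixE.
have bprod i : bmfun (fun w => \prod_(1 <= l < i) (1 - G l (X l w))).
  by apply: bmfun_prod => l; apply: bmfunB; [exact: bmfun_cst|exact: bm].
rewrite expect_sum; last first.
  move=> i; apply: bmfunM => //; apply: bmfunD; apply: bmfunZ; exact: bm.
apply: eq_big_nat => -[//|i] _.
have step (f : R -> R) : unitfun f ->
    \int[P]_w ((\prod_(1 <= l < i.+1) (1 - G l (X l w))) * f (X i.+1 w)) =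
    (\prod_(1 <= l < i.+1) (1 - \int[P]_w G l (X 1%N w))) * \int[P]_w f (X 1%N w).
  move=> uf; pose h l : R -> R := if l == i.+1 then f else fun x => 1 - G l x.
  have hE l : (l < i.+1)%N -> h l = fun x => 1 - G l x.
    by move=> li; rewrite /h ltn_eqF.
  have hi : h i.+1 = f by rewrite /h eqxx.
  transitivity (\int[P]_w (\prod_(1 <= j < i.+2) h j (X j w))).
    apply: eq_Rintegral => w _; rewrite [RHS]big_nat_recr//= hi; congr (_ * _).
    by apply: eq_big_nat => l /andP[_ li]; rewrite hE.
  rewrite (expect_prod indX idX); last first.
    by move=> l; rewrite /h; case: ifP => // _; exact: unitfun_onem.
  rewrite big_nat_recr//= hi; congr (_ * _).
  apply: eq_big_nat => l /andP[_ li]; rewrite hE//.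
  by rewrite expect_onem//; exact: bm.
under eq_Rintegral do rewrite mulrDr mulrCA [X in _ + X]mulrCA.
rewrite expectD; last 2 first.
- by apply: bmfunZ; apply: bmfunM => //; exact: bm.
- by apply: bmfunZ; apply: bmfunM => //; exact: bm.
rewrite !expectZ; last 2 first.
- by apply: bmfunM => //; exact: bm.
- by apply: bmfunM => //; exact: bm.
by rewrite !step// [RHS]mulrDr; congr (_ + _); exact: mulrCA.
Qed.

(** Here [u (X i)] is the winning probability of the lottery replacing the excess over [a].
    [le_stop_mix] bounds all returns pathwise by one mixture, whose mean follows from independence.
    The first observation is paid in [a - c], whence [i.-1]. *)
Lemma prophet_value_le (c a p : R) (n : nat) : 0 <= c -> 0 <= a <= 1 -> (1 <= n)%N ->
  p = \int[P]_w (Num.max 0 (clip (X 1%N w) - a) / (1 - a)) ->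
  (prophet_value P (net_return X c) n <=
   (a - c + \sum_(1 <= i < n.+1)
      p * (1 - p) ^+ i.-1 * Num.max 0 (1 - a - i.-1%:R * c))%:E)%E.
Proof.
move=> c0 /andP[a0 a1] n1 pE.
pose u x := Num.max 0 (clip x - a) / (1 - a).
have uu : unitfun u by apply: unitfun_excess; rewrite a0 a1.
pose b i := Num.max 0 (1 - a - i.-1%:R * c).
have bX i : bmfun (fun w => u (X i w)) by apply: unitfun_bmfun.
pose Z i w := clip (X i w) - i%:R * c.
have bZ i : bmfun (Z i).
  apply: bmfunB; last exact: bmfun_cst.
  by apply: unitfun_bmfun => //; exact: unitfun_clip.
have bS : bmfun (fun w => stop_mix (fun i => u (X i w)) (fun i => u (X i w) * b i) 1 n).
  apply: (bmfun_stop_mix (g := fun i w => u (X i w))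
    (r := fun i w => u (X i w) * b i)) => i; first exact: bX.
  by apply: bmfunM; [exact: bX|exact: bmfun_cst].
rewrite /prophet_value (@expectation_ae_eq _
    (fun w => \big[Num.max/Z 1%N w]_(1 <= i < n.+1) Z i w)); first last.
- apply: filterS ae_clip => w H; rewrite /net_return /Z H//.
  by apply: eq_big_nat => i /andP[i1 _]; rewrite H.
- by case: (bmfun_bigmax (index_iota 1 n.+1) (bZ 1%N) bZ).
- have mY i : measurable_fun setT (net_return X c i).
    by apply: measurable_funB; [exact: mX|exact: measurable_cst].
  exact: measurable_bigmax.
rewrite expectationE; last exact: bmfun_bigmax.
rewrite lee_fin -stop_mix_cst.
have -> : stop_mix (fun _ => p) (fun i => p * b i) 1 n =
    \int[P]_w stop_mix (fun i => u (X i w)) (fun i => u (X i w) * b i) 1 n.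
  have := @expect_stop_mix (fun _ => u) (fun _ => u) (fun _ => u) b (fun _ => 0) n.
  move=> /(_ (fun _ => uu) (fun _ => uu) (fun _ => uu)) H.
  transitivity (\int[P]_w stop_mix (fun i => u (X i w))
    (fun i => b i * u (X i w) + 0 * u (X i w)) 1 n).
    rewrite H (esym pE : _ = p); congr (stop_mix _ _ _ _); apply/funext => i.
    by rewrite mul0r addr0 mulrC.
  apply: eq_Rintegral => w _; congr (stop_mix _ _ _ _); apply/funext => i.
  by rewrite mul0r addr0 mulrC.
rewrite -[X in X + _](expect_cst P) -expectD//; last exact: bmfun_cst.
apply: expect_le.
- exact: bmfun_bigmax.
- by apply: bmfunD => //; exact: bmfun_cst.
move=> w.
have ZS i : (1 <= i < n.+1)%N ->
    Z i w <= a - c + stop_mix (fun i => u (X i w)) (fun i => u (X i w) * b i) 1 n.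
  move=> i1n; have u01 j : 0 <= u (X j w) <= 1 by exact: (proj2 uu).
  pose z j := (1 - a) * u (X j w) - j.-1%:R * c.
  apply: (@le_trans _ _ (a - c + z i)).
    have exc : clip (X i w) - a <= (1 - a) * u (X i w).
      by rewrite /u mulrC excess_mulVK// le_max lexx orbT.
    rewrite /Z /z; case: i i1n exc => // i _ exc.
    by rewrite -natr1/=; lra.
  rewrite lerD2l; apply: (le_stop_mix u01) => //.
  - by move=> j; rewrite /b le_max lexx.
  - move=> j; rewrite /b /= ge_max le_max lexx/= le_max.
    apply/orP; right; rewrite lerD2l lerN2 ler_wpM2r// ler_nat; exact: leq_pred.
  - move=> j; have /andP[u0 u1] := u01 j.
    apply: (@le_trans _ _ (u (X j w) * (1 - a - j.-1%:R * c))); last first.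
      by rewrite ler_wpM2l// /b le_max lexx orbT.
    rewrite /z; have : 0 <= j.-1%:R * c by rewrite mulr_ge0.
    by set y := j.-1%:R * c; nra.
rewrite big_nat; elim/big_ind : _ => //; first by apply: ZS; rewrite /= ltnS.
by move=> x y xS yS; rewrite ge_max xS.
Qed.

Lemma measurable_stop_mix (g r : nat -> T -> R) k m :
  (forall i, measurable_fun setT (g i)) -> (forall i, measurable_fun setT (r i)) ->
  measurable_fun setT (fun w => stop_mix (g ^~ w) (r ^~ w) k m).
Proof.
move=> mg mr; elim: m k => [|m IH] k /=; first exact: measurable_cst.
apply: measurable_funD => //; apply: measurable_funM => //.
by apply: measurable_funB => //; exact: measurable_cst.
Qed.

Lemma measurable_le_clip (t : R) : measurable [set x | t <= clip x].
Proof.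
rewrite [X in measurable X](_ : _ = clip @^-1` `[t, +oo[); last first.
  by apply/seteqP; split => x /=; rewrite in_itv/= andbT.
by rewrite -[X in measurable X]setTI; apply: (proj1 unitfun_clip).
Qed.

Lemma natural_filtration_le (c t : R) (i k : nat) : (1 <= i <= k)%N ->
  natural_filtration (net_return X c) k [set w | t <= clip (X i w)].
Proof.
case: i => // i /= ik; apply: sub_sigma_algebra.
apply: (@bigsetU_sup _ i k (fun j => preimage_set_system setT
  (net_return X c j.+1) measurable)) => //=.
exists [set y | t <= clip (y + i.+1%:R * c)].
  have mf : measurable_fun [set: R] (fun y : R => y + i.+1%:R * c).
    by apply: measurable_funD; [exact: measurable_id|exact: measurable_cst].
  have := mf measurableT _ (measurable_le_clip t).
  by rewrite setTI.
by rewrite setTI; apply/seteqP; split => w /=; rewrite /net_return subrK.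
Qed.

Lemma natural_filtration_has (c : R) (t : nat -> R) (k : nat) :
  natural_filtration (net_return X c) k
    [set w | has (fun i => t i <= clip (X i w)) (iota 1 k)].
Proof.
rewrite [X in natural_filtration _ _ X](_ : _ = \bigcup_i
    (if (1 <= i <= k)%N then [set w | t i <= clip (X i w)] else set0)); last first.
  apply/seteqP; split => w /=.
    move=> /hasP[i]; rewrite mem_iota add1n ltnS => ik tX.
    by exists i => //; rewrite ik.
  move=> [i _]; case: ifPn => // ik tX.
  by apply/hasP; exists i => //; rewrite mem_iota add1n ltnS.
apply: sigma_algebra_bigcup => i; case: ifPn => ik.
  exact: natural_filtration_le.
exact: sigma_algebra0.
Qed.

(* Dynamic programming value with [k] observations left.  The value 0 at [k = 0]
   only serves to give [E X - c] at [k = 1], because [X >= 0]. *)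
Fixpoint cont_value (c : R) (k : nat) : R :=
  if k is k'.+1 then
    \int[P]_w Num.max (clip (X 1%N w)) (cont_value c k') - c
  else 0.

(** One step of the threshold rule: the first integral is the gain from stopping, the rest the value
    [t] of going on. *)
Lemma expect_max_clip (t : R) :
  \int[P]_w Num.max (clip (X 1%N w)) t =
  \int[P]_w (\1_[set x | t <= clip x] (X 1%N w) * clip (X 1%N w)) +
  (1 - \int[P]_w \1_[set x | t <= clip x] (X 1%N w)) * t.
Proof.
have bG : bmfun (fun w => \1_[set x | t <= clip x] (X 1%N w) : R).
  apply: unitfun_bmfun => //; apply: unitfun_indic; exact: measurable_le_clip.
have bC : bmfun (fun w => clip (X 1%N w)).
  by apply: unitfun_bmfun => //; exact: unitfun_clip.
rewrite mulrBl mul1r mulrC -expectZ// -[X in _ = _ + (X - _)](expect_cst P).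
rewrite -expectB; [|exact: bmfun_cst|exact: bmfunZ].
rewrite -expectD; [|exact: bmfunM|]; last first.
  by apply: bmfunB; [exact: bmfun_cst|exact: bmfunZ].
apply: eq_Rintegral => w _; rewrite indicE; have [tx|tx] := leP t (clip (X 1%N w)).
  by rewrite mem_set// mul1r mulr1 subrr addr0.
rewrite memNset/=; last by rewrite leNgt tx.
by rewrite mul0r mulr0 subr0 add0r.
Qed.

Lemma le_statistician_value (c : R) (n : nat) : (1 <= n)%N ->
  ((cont_value c n)%:E <= statistician_value P (net_return X c) n)%E.
Proof.
move=> n1.
(* The threshold is the value of going on after [i]. At [i = n] it is 0, so the rule always stops by
   then. *)
pose t i := cont_value c (n - i).
pose a w i := t i <= clip (X i w).
pose tau w := (1 + find (a w) (iota 1 n))%N.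
have hasa w : has (a w) (iota 1 n).
  apply/hasP; exists n; first by rewrite mem_iota n1 add1n ltnSn.
  by rewrite /a /t subnn; case/andP: (clip01 (X n w)).
apply: ereal_sup_ubound; exists tau.
  split=> [w|k /andP[k1 kn]].
    by rewrite /tau add1n ltnS /= -[X in (_ < X)%N](size_iota 1 n) -has_find.
  rewrite [X in natural_filtration _ _ X](_ : _ =
      [set w | has (a w) (iota 1 k)]); first exact: natural_filtration_has.
  apply/funext => w /=; rewrite /tau add1n -has_take// take_iota.
  by rewrite (minn_idPl kn).
pose g i x : R := \1_[set x | t i <= clip x] x.
have ug i : unitfun (g i) by apply: unitfun_indic; exact: measurable_le_clip.
have gE i w : g i (X i w) = (a w i)%:R.
  by rewrite /g indicE /a; congr (nat_of_bool _)%:R; rewrite mem_setE.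
have uF i : unitfun (fun x => g i x * clip x).
  split; first exact: measurable_funM (proj1 (ug i)) (proj1 unitfun_clip).
  move=> x; have /andP[g0 g1] := proj2 (ug i) x; have /andP[c0 c1] := clip01 x.
  by rewrite mulr_ge0//= mulr_ile1.
pose S w := stop_mix (fun i => g i (X i w))
  (fun i => 1 * (g i (X i w) * clip (X i w)) + (- (i%:R * c)) * g i (X i w)) 1 n.
have bg i : bmfun (fun w => g i (X i w)) by exact: unitfun_bmfun.
have bF i : bmfun (fun w => g i (X i w) * clip (X i w)).
  exact: (unitfun_bmfun (mX i) (uF i)).
have bS : bmfun S.
  apply: (bmfun_stop_mix (g := fun i w => g i (X i w)) (r := fun i w =>
     1 * (g i (X i w) * clip (X i w)) + (- (i%:R * c)) * g i (X i w))) => // i.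
  by apply: bmfunD; exact: bmfunZ.
have YtauE w : net_return X c (tau w) w = stop_mix (fun i => g i (X i w))
    (fun i => g i (X i w) * net_return X c i w) 1 n.
  rewrite -(stop_mix_find (net_return X c ^~ w) (hasa w)).
  by congr (stop_mix _ _ _ _); apply/funext => i; rewrite gE.
rewrite (@expectation_ae_eq _ S); first last.
- apply: filterS ae_clip => w H; rewrite YtauE /S !stop_mixE.
  apply: eq_big_nat => i /andP[i1 _]; congr (_ * _).
  by rewrite /net_return H//; ring.
- by case: bS.
- under eq_fun do rewrite YtauE.
  apply: (measurable_stop_mix (g := fun i w => g i (X i w))
    (r := fun i w => g i (X i w) * net_return X c i w)) => i; first by case: (bg i).
  apply: measurable_funM; first by case: (bg i).
  by apply: measurable_funB; [exact: mX|exact: measurable_cst].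
rewrite expectationE//; congr (_%:E).
apply: (etrans (@expect_stop_mix g (fun i x => g i x * clip x) g (fun _ => 1)
  (fun i => - (i%:R * c)) n ug uF ug)).
set gam := fun i => \int[P]_w g i (X 1%N w).
set r := fun i => _ + _.
(* Backward induction: after [k] observations, with [m] left, the rule is worth the continuation
   value less the costs already paid. *)
suff bw m k : (k + m = n)%N -> (1 <= m)%N ->
    stop_mix gam r k.+1 m = cont_value c m - k%:R * c.
  by rewrite bw ?add0n// mul0r subr0.
elim: m k => // m IH k kmn _.
have tk : t k.+1 = cont_value c m by rewrite /t -kmn addnS -addSn addKn.
(* At the last index the empty mixture is 0, which differs from the formula, but [gam k.+1 = 1]
   cancels both sides. *)
have {}IH : (1 - gam k.+1) * stop_mix gam r k.+2 m =
    (1 - gam k.+1) * (cont_value c m - k.+1%:R * c).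
  case: m => [|m] in kmn tk IH *; last by rewrite IH// -kmn addSnnS.
  rewrite (_ : gam k.+1 = 1) ?subrr ?mul0r//.
  transitivity (\int[P]_w (1 : R)); last exact: expect_cst.
  apply: eq_Rintegral => w _; rewrite /g indicE mem_set//= tk.
  by case/andP: (clip01 (X 1%N w)).
rewrite /= IH /r expect_max_clip -tk.
rewrite -/(g k.+1) -/(gam k.+1) mul1r -natr1; ring.
Qed.

Let bC : bmfun (fun w => clip (X 1%N w)).
Proof. by apply: unitfun_bmfun => //; exact: unitfun_clip. Qed.

Let bCmax t : bmfun (fun w => Num.max (clip (X 1%N w)) t).
Proof. by apply: bmfun_max => //; exact: bmfun_cst. Qed.

Lemma cont_valueS c k : cont_value c k.+1 =
  \int[P]_w Num.max (clip (X 1%N w)) (cont_value c k) - c.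
Proof. by []. Qed.

Lemma cont_value1 c : cont_value c 1 = \int[P]_w clip (X 1%N w) - c.
Proof.
rewrite /=; congr (_ - _); apply: eq_Rintegral => w _; apply: max_l.
by case/andP: (clip01 (X 1%N w)).
Qed.

Lemma cont_value_le1 c k : 0 <= c -> cont_value c k <= 1.
Proof.
move=> c0; elim: k => [|k IH] /=; first exact: ler01.
apply: (@le_trans _ _ (\int[P]_w (1 : R))).
  rewrite lerBlDr -[leLHS]addr0 lerD//.
  apply: expect_le => // [|w]; first exact: bmfun_cst.
  by rewrite ge_max IH andbT; case/andP: (clip01 (X 1%N w)).
by rewrite expect_cst.
Qed.

Lemma cont_value_leS c k : c <= \int[P]_w clip (X 1%N w) ->
  cont_value c k <= cont_value c k.+1.
Proof.
move=> cmu; elim: k => [|k IH]; first by rewrite cont_value1 subr_ge0.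
rewrite (cont_valueS c k.+1) [leLHS]cont_valueS lerD2r; apply: expect_le => // w.
rewrite ge_max; apply/andP; split; rewrite le_max; first by rewrite lexx.
by apply/orP; right; exact: IH.
Qed.

Lemma cont_value_homo c : c <= \int[P]_w clip (X 1%N w) ->
  {homo cont_value c : k m / (k <= m)%N >-> k <= m}.
Proof.
by move=> cmu; apply: homo_leq => // [? ? ?|k]; [exact: le_trans|exact: cont_value_leS].
Qed.

(** The continuation value [E X - c] is at most 0, so taking the maximum with it never changes
    anything. *)
Lemma cont_value_low c k : \int[P]_w clip (X 1%N w) <= c ->
  cont_value c k.+1 = \int[P]_w clip (X 1%N w) - c.
Proof.
move=> muc; elim: k => [|k IH]; first exact: cont_value1.
rewrite [LHS]/= -/(cont_value c k.+1) IH; congr (_ - _).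
apply: eq_Rintegral => w _; apply: max_l; apply: (@le_trans _ _ 0).
  by rewrite subr_le0.
by case/andP: (clip01 (X 1%N w)).
Qed.

(** Pointwise: above [a] both maxima equal the variable; below [a] the excess ratio is 0 and the
    difference is at most [z - y]. *)
Lemma max_clip_slope (a p y z : R) : 0 <= a <= 1 -> y <= z <= a ->
  p = \int[P]_w (Num.max 0 (clip (X 1%N w) - a) / (1 - a)) ->
  \int[P]_w Num.max (clip (X 1%N w)) z - \int[P]_w Num.max (clip (X 1%N w)) y
    <= (1 - p) * (z - y).
Proof.
move=> a01 /andP[yz za] ->; have uu := unitfun_excess a01.
have bu := unitfun_bmfun (mX 1%N) uu.
rewrite -expect_onem// mulrC -expectZ; last by apply: bmfunB => //; exact: bmfun_cst.
rewrite -expectB//; apply: expect_le.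
- exact: bmfunB.
- by apply: bmfunZ; apply: bmfunB => //; exact: bmfun_cst.
move=> w; have /andP[u0 u1] := proj2 uu (X 1%N w).
have [xa|xa] := leP (clip (X 1%N w)) a.
  rewrite (_ : Num.max 0 _ = 0); last by rewrite max_l// subr_le0.
  rewrite mul0r subr0 mulr1; move: (clip (X 1%N w)) => x.
  by case: (leP x z); case: (leP x y); lra.
rewrite (max_l (ltW (le_lt_trans za xa))).
rewrite (max_l (ltW (le_lt_trans (le_trans yz za) xa))) subrr.
by rewrite mulr_ge0 ?subr_ge0.
Qed.

Lemma expect_excess (a p : R) : 0 <= a <= 1 ->
  p = \int[P]_w (Num.max 0 (clip (X 1%N w) - a) / (1 - a)) ->
  \int[P]_w Num.max (clip (X 1%N w)) a = a + p * (1 - a).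
Proof.
move=> a01 ->; have uu := unitfun_excess a01.
have bu := unitfun_bmfun (mX 1%N) uu.
rewrite mulrC -expectZ// -[X in X + _](expect_cst P a) -expectD; last 2 first.
- exact: bmfun_cst.
- exact: bmfunZ.
apply: eq_Rintegral => w _; case/andP: a01 => _ a1.
rewrite mulrC excess_mulVK//; move: (clip _) => x.
by case: (leP x a) => xa; [rewrite max_l ?addr0// subr_le0|rewrite max_r; lra].
Qed.

Lemma expect_unit01 (f : R -> R) : unitfun f -> 0 <= \int[P]_w f (X 1%N w) <= 1.
Proof.
move=> uf; have bf := unitfun_bmfun (mX 1%N) uf; apply/andP; split.
  by apply: Rintegral_ge0 => w _; case/andP: (proj2 uf (X 1%N w)).
rewrite -[leRHS](expect_cst P); apply: expect_le => // [|w].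
  exact: bmfun_cst.
by case/andP: (proj2 uf (X 1%N w)).
Qed.

(* The increments of [cont_value] decrease at least geometrically, with ratio
   [1 - p], up to index [N]. *)
Lemma cont_value_deficit (c p : R) (N : nat) : 0 <= c ->
  c <= \int[P]_w clip (X 1%N w) ->
  p = \int[P]_w (Num.max 0 (clip (X 1%N w) - cont_value c N) / (1 - cont_value c N)) ->
  (p - c) * (1 - (1 - p) ^+ N) <= p * cont_value c N.
Proof.
move=> c0 cmu pE; set a := cont_value c N in pE *.
have a01 : 0 <= a <= 1.
  by rewrite cont_value_le1// andbT; exact: (cont_value_homo cmu (leq0n N)).
have /andP[p0 p1] : 0 <= p <= 1 by rewrite pE; exact: (expect_unit01 (unitfun_excess a01)).
have step k : (k < N)%N -> cont_value c k.+2 - cont_value c k.+1 <=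
    (1 - p) * (cont_value c k.+1 - cont_value c k).
  move=> kN.
  have := max_clip_slope (y := cont_value c k) (z := cont_value c k.+1) a01.
  move=> /(_ p) /=; rewrite -/(cont_value c k.+1) => H.
  rewrite opprB addrA subrK; apply: H => //.
  by rewrite (cont_value_leS k cmu); exact: (cont_value_homo cmu kN).
(* Division-free form of summing the earlier increments, each at least [(1 - p)^-1] times the next
   one when [p < 1]. *)
have H k : (k <= N)%N -> (cont_value c k.+1 - cont_value c k) * (1 - (1 - p) ^+ k) <=
    (1 - p) ^+ k * (p * cont_value c k).
  elim: k => [|k IH] kN; first by rewrite expr0 subrr mulr0 /= !mulr0.
  have := IH (ltnW kN); have := step k kN.
  rewrite exprS; set q := 1 - p; set e := q ^+ k.
  have q0 : 0 <= q by rewrite /q; lra.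
  have q1 : q <= 1 by rewrite /q; lra.
  have e0 : 0 <= e by exact: exprn_ge0.
  have e1 : e <= 1 by exact: exprn_ile1.
  have qe1 : 0 <= 1 - q * e by rewrite subr_ge0 mulr_ile1.
  set x := cont_value c k; set y := cont_value c k.+1; set z := cont_value c k.+2.
  move=> S1 S2.
  apply: (le_trans (ler_wpM2r qe1 S1)).
  have := ler_wpM2l q0 S2.
  have -> : q * (y - x) * (1 - q * e) = q * ((y - x) * (1 - e)) + q * e * p * (y - x).
    by rewrite (_ : p = 1 - q) ?/q; ring.
  lra.
(* The last increment is [p * (1 - a) - c]; substituting it and rearranging gives the claim. *)
have := H N (leqnn N); rewrite -/a.
have -> : cont_value c N.+1 = a + p * (1 - a) - c.
  by rewrite /= (expect_excess a01 pE).
by set e := (1 - p) ^+ N; lra.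
Qed.

Lemma regret_le (c : R) (n : nat) : 0 <= c -> (1 <= n)%N ->
  (exists2 N, (N < n)%N & exists2 p : R, c <= p <= 1 &
     (regret X c n <= (N%:R * p * (1 - p) ^+ N.+1)%:E)%E) \/
  (exists2 p : R, 0 <= p <= 1 /\ p <= c & (regret X c n <=
     (\sum_(1 <= j < n) p * (1 - p) ^+ j * Num.max 0 (1 - j%:R * c))%:E)%E).
Proof.
move=> c0 n1.
have regE a p b : 0 <= a <= 1 ->
    p = \int[P]_w (Num.max 0 (clip (X 1%N w) - a) / (1 - a)) ->
    a - c + p * (1 - a) +
      \sum_(1 <= j < n) p * (1 - p) ^+ j * Num.max 0 (1 - a - j%:R * c)
      - cont_value c n <= b -> (regret X c n <= b%:E)%E.
  move=> a01 pE H; apply: (@le_trans _ _ (a - c + p * (1 - a) +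
      \sum_(1 <= j < n) p * (1 - p) ^+ j * Num.max 0 (1 - a - j%:R * c)
      - cont_value c n)%:E); last by rewrite lee_fin.
  rewrite EFinB /regret; apply: leeB; last exact: le_statistician_value.
  apply: le_trans (prophet_value_le c0 a01 n1 pE) _.
  rewrite lee_fin big_ltn ?ltnS// expr0 mulr1 mul0r subr0 max_r; last first.
    by rewrite subr_ge0; case/andP: a01.
  by rewrite big_add1/= addrA.
case: n n1 regE => // N _ regE.
have [cmu|muc] := leP c (\int[P]_w clip (X 1%N w)); last first.
  (* At level [a = 0] the excess ratio is the variable itself, and [mu - c] cancels against the
     continuation value. *)
  right; set mu := \int[P]_w _ in muc; exists mu.
    by split; [exact: (expect_unit01 unitfun_clip)|exact: ltW].
  have muE : mu = \int[P]_w (Num.max 0 (clip (X 1%N w) - 0) / (1 - 0)).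
    apply: eq_Rintegral => w _; rewrite !subr0 divr1 max_r//.
    by case/andP: (clip01 (X 1%N w)).
  apply: (regE _ _ _ _ muE); first by rewrite lexx ler01.
  rewrite (cont_value_low _ (ltW muc)) -/mu.
  under eq_bigr do rewrite subr0.
  by lra.
left; set a := cont_value c N.
pose p := \int[P]_w (Num.max 0 (clip (X 1%N w) - a) / (1 - a)).
have a01 : 0 <= a <= 1.
  by rewrite cont_value_le1// andbT; exact: (cont_value_homo cmu (leq0n N)).
have /andP[p0 p1] : 0 <= p <= 1 by exact: (expect_unit01 (unitfun_excess a01)).
have vE : cont_value c N.+1 = a + p * (1 - a) - c.
  by rewrite /= (@expect_excess a p).
(* Monotonicity of the continuation values gives [c <= p * (1 - a)]. *)
have cp : c <= p.
  have := cont_value_leS N cmu; rewrite vE -/a.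
  by case/andP: a01 => a0 a1; nra.
have c0p : 0 <= c <= p by rewrite c0.
have [M MN HM] := truncated_geo_sum_le c0p p1 (cont_value_deficit c0 cmu erefl).
exists M => //; exists p; first by rewrite cp.
apply: (regE a p _ a01 erefl); rewrite vE -/a; move: HM; rewrite -/p -/a.
by set S := \sum_(_ <= _ < _) _; lra.
Qed.

End upper_bound.

(** * Bernoulli sequences *)

Section bernoulli_sequence.
Context (R : realType).
Notation mu := (@lebesgue_measure R).
Notation TR := (measurableTypeR R).

Definition affine (a b : R) : TR -> TR := fun x => a * x + b.

Lemma measurable_affine (a b : R) : measurable_fun setT (affine a b).
Proof.
apply: measurable_funD; last exact: measurable_cst.
by apply: measurable_funM; [exact: measurable_cst|exact: measurable_id].
Qed.

(** By uniqueness of Lebesgue measure: [a] times the image measure agrees with it on half-open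
    intervals. *)
Lemma lebesgue_measure_affine (a b : R) (A : set R) : 0 < a -> measurable A ->
  mu (affine a b @^-1` A) = (a^-1%:E * mu A)%E.
Proof.
move=> a0 mA.
have a0' : 0 <= a by exact: ltW.
pose m := mscale (NngNum a0') (pushforward mu (affine a b)).
have : mu A = m (measurable_affine a b) A.
  apply: (lebesgue_measure_unique (mu := m (measurable_affine a b))) => // _ [[x y]] _ <-.
  transitivity (a%:E * mu (affine a b @^-1` `]x, y]%classic))%E; last by [].
  have -> : affine a b @^-1` `]x, y] = `](x - b) / a, (y - b) / a]%classic.
    apply/seteqP; split => z /=; rewrite !in_itv/= /affine;
      by rewrite ltr_pdivrMr// ler_pdivlMr// ltrBlDr lerBrDr mulrC.
  rewrite !lebesgue_measure_itv/= !lte_fin ltr_pM2r ?invr_gt0// ltrD2r.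
  case: ifP => _; last by rewrite mule0.
  by rewrite -!EFinB -EFinM; congr (_%:E); field; rewrite gt_eqF.
move=> ->; rewrite /m /mscale /pushforward /= muleA -EFinM.
by rewrite mulVf ?gt_eqF// mul1e.
Qed.

Let mI : measurable (`[0%R, 1%R[%classic : set TR). Proof. exact: measurable_itv. Qed.

(** Uniform law on [0, 1[, carried by the whole line so that [shift] is a total map of the space. *)
Definition unit_prob : set TR -> \bar R := mrestr mu mI.

HB.instance Definition _ := Measure.on unit_prob.

Let unit_prob_setT : unit_prob setT = 1%E.
Proof.
by rewrite /unit_prob /mrestr setTI /= lebesgue_measure_itv/= lte_fin ltr01 oppr0 addr0.
Qed.

HB.instance Definition _ := Measure_isProbability.Build _ _ _ unit_prob unit_prob_setT.

Variable p : R.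
Hypothesis p01 : 0 < p < 1.

Definition success : set TR := [set x | x < p].

(* The [p]-shift: the first branch rescales [0, p[ onto [0, 1[ and the second
   one rescales [p, 1[, so that the branch taken is independent of the image. *)
Definition shift (x : TR) : TR :=
  if x < p then affine p^-1 0 x else affine (1 - p)^-1 (- (p / (1 - p))) x.

Definition trial (x : TR) : R := \1_success x.

Let p0 : 0 < p. Proof. by case/andP: p01. Qed.
Let q0 : 0 < 1 - p. Proof. by rewrite subr_gt0; case/andP: p01. Qed.

Lemma measurable_success : measurable success.
Proof.
rewrite (_ : success = `]-oo, p[%classic); first exact: measurable_itv.
by apply/seteqP; split => x /=; rewrite in_itv.
Qed.

Lemma measurable_shift : measurable_fun setT shift.
Proof.
apply: measurable_fun_ifT; [|exact: measurable_affine|exact: measurable_affine].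
exact: measurable_fun_ltr.
Qed.

Lemma measurable_trial : measurable_fun setT trial.
Proof. by apply: measurable_indic; exact: measurable_success. Qed.

Lemma unit_prob_success (C : set TR) : measurable C ->
  unit_prob (success `&` shift @^-1` C) = (p%:E * unit_prob C)%E.
Proof.
move=> mC; rewrite /unit_prob /mrestr.
have -> : success `&` shift @^-1` C `&` `[0, 1[%classic =
    affine p^-1 0 @^-1` (C `&` `[0, 1[%classic).
  apply/seteqP; split => x; rewrite /success /shift /affine /= !in_itv/= addr0.
    move=> [[xp] + /andP[x0 x1]]; rewrite xp => Cx; split => //.
    apply/andP; split; first by apply: mulr_ge0 => //; rewrite invr_ge0 ltW.
    by rewrite mulrC ltr_pdivrMr// mul1r.
  move=> [Cx /andP[h0 h1]].
  have xp : x < p by move: h1; rewrite mulrC ltr_pdivrMr// mul1r.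
  have x0 : 0 <= x by move: h0; rewrite pmulr_rge0 ?invr_gt0.
  by rewrite xp x0/= (lt_trans xp)//; case/andP: p01.
by rewrite lebesgue_measure_affine ?invr_gt0// ?invrK//; exact: measurableI.
Qed.

Lemma unit_prob_failure (C : set TR) : measurable C ->
  unit_prob (~` success `&` shift @^-1` C) = ((1 - p)%:E * unit_prob C)%E.
Proof.
move=> mC; rewrite /unit_prob /mrestr.
have -> : ~` success `&` shift @^-1` C `&` `[0, 1[%classic =
    affine (1 - p)^-1 (- (p / (1 - p))) @^-1` (C `&` `[0, 1[%classic).
  have affE x : affine (1 - p)^-1 (- (p / (1 - p))) x = (x - p) / (1 - p).
    by rewrite /affine mulrBl mulrC.
  apply/seteqP; split => x; rewrite /success /shift /= !in_itv/= affE.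
    move=> [[/negP xp] + /andP[x0 x1]]; rewrite (negbTE xp) => Cx; split => //.
    rewrite -leNgt in xp.
    apply/andP; split.
      by apply: divr_ge0; [rewrite subr_ge0|exact: ltW].
    by rewrite ltr_pdivrMr// mul1r ltrD2r.
  move=> [Cx /andP[+ +]].
  rewrite pmulr_lge0 ?invr_gt0// subr_ge0 => xp.
  rewrite ltr_pdivrMr// mul1r ltrD2r => x1.
  have -> : (x < p) = false by apply/negbTE; rewrite -leNgt.
  by rewrite x1 (le_trans _ xp) ?ltW//; split => //; split.
by rewrite lebesgue_measure_affine ?invr_gt0// ?invrK//; exact: measurableI.
Qed.

(** The Bernoulli law of parameter [p]. *)
Definition trial_weight (A : set R) : R :=
  p * (1 \in A)%:R + (1 - p) * (0 \in A)%:R.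

(** Each branch of [shift] maps its piece affinely onto [0, 1[. Thus the trial is independent of the
    shifted point, whose law is again uniform. *)
Lemma unit_prob_trial (A : set R) (C : set TR) : measurable A -> measurable C ->
  unit_prob (trial @^-1` A `&` shift @^-1` C) =
  ((trial_weight A)%:E * unit_prob C)%E.
Proof.
move=> mA mC.
have mS : measurable (shift @^-1` C).
  by rewrite -[X in measurable X]setTI; exact: measurable_shift.
have mTS : measurable (trial @^-1` A `&` shift @^-1` C).
  apply: measurableI => //.
  by rewrite -[X in measurable X]setTI; exact: measurable_trial.
rewrite (measureDI _ mTS measurable_success).
rewrite (_ : _ `\` success = if 0 \in A then ~` success `&` shift @^-1` C else set0);
    last first.
  apply/seteqP; split => x /=; rewrite /trial.
    by move=> [[+ Cx] sx]; rewrite indicE memNset// => A0; rewrite mem_set.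
  case: ifPn => //; rewrite inE => A0 [sx Cx]; split => //; split => //.
  by rewrite indicE memNset.
rewrite (_ : _ `&` success = if 1 \in A then success `&` shift @^-1` C else set0);
    last first.
  apply/seteqP; split => x /=; rewrite /trial.
    by move=> [[+ Cx] sx]; rewrite indicE mem_set// => A1; rewrite mem_set.
  case: ifPn => //; rewrite inE => A1 [sx Cx]; split => //; split => //.
  by rewrite indicE mem_set.
rewrite /trial_weight EFinD ge0_muleDl ?lee_fin ?mulr_ge0// ?ltW//.
rewrite addeC; congr (_ + _)%E; case: ifPn => _.
- by rewrite mulr1; exact: unit_prob_success.
- by rewrite mulr0 mul0e measure0.
- by rewrite mulr1; exact: unit_prob_failure.
- by rewrite mulr0 mul0e measure0.
Qed.

Lemma trial_weightT : trial_weight setT = 1.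
Proof. by rewrite /trial_weight !in_setT !mulr1 subrKC. Qed.

Definition trials (j : nat) (x : TR) : R := trial (iter j.-1 shift x).

Lemma measurable_trials j : measurable_fun setT (trials j).
Proof.
apply: (measurableT_comp measurable_trial).
by elim: j.-1 => [|k IH]; [exact: measurable_id|exact: measurableT_comp measurable_shift IH].
Qed.

HB.instance Definition _ (j : nat) :=
  isMeasurableFun.Build _ _ _ _ (trials j) (measurable_trials j).

Lemma unit_prob_trials (n : nat) (A : nat -> set R) : (forall j, measurable (A j)) ->
  let B := [set x | forall j, (j < n)%N -> A j (trial (iter j shift x))] in
  measurable B /\ unit_prob B = (\prod_(0 <= j < n) trial_weight (A j))%:E.
Proof.
elim: n A => [|n IH] A mA /=.
  rewrite [X in measurable X](_ : _ = setT); last first.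
    by apply/seteqP; split.
  rewrite [X in unit_prob X](_ : _ = setT); last first.
    by apply/seteqP; split.
  by split; rewrite ?big_geq//; exact: unit_prob_setT.
have [/= mB PB] := IH (fun j => A j.+1) (fun j => mA j.+1).
set B := [set x | _] in mB PB.
have -> : [set x | forall j, (j < n.+1)%N -> A j (trial (iter j shift x))] =
    trial @^-1` (A 0%N) `&` shift @^-1` B.
  apply/seteqP; split => x /=.
    move=> H; split; first exact: (H 0%N).
    by move=> j jn; have := H j.+1; rewrite iterSr; exact.
  by move=> [A0 H] [|j] jn //; rewrite iterSr; exact: H.
split.
  apply: measurableI.
    by rewrite -[X in measurable X]setTI; exact: measurable_trial.
  by rewrite -[X in measurable X]setTI; exact: measurable_shift.
by rewrite unit_prob_trial// PB -EFinM big_nat_recl.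
Qed.

Lemma distribution_trials (j : nat) (A : set R) : (1 <= j)%N -> measurable A ->
  unit_prob (trials j @^-1` A) = (trial_weight A)%:E.
Proof.
move=> j1 mA; pose B i : set R := if i == j.-1 then A else setT.
have [|_] := @unit_prob_trials j B.
  by move=> i; rewrite /B; case: ifP => // _; exact: measurableT.
rewrite [X in unit_prob X = _ -> _](_ : _ = trials j @^-1` A); last first.
  apply/seteqP; split => x /=.
    by move=> /(_ j.-1); rewrite /B eqxx prednK//; apply.
  by move=> Ax i ij; rewrite /B; case: eqP => // ->.
case: j j1 @B => // j _ /= ->; rewrite big_nat_recr//= eqxx big1_seq ?mul1r//.
move=> i /=; rewrite mem_index_iota => /andP[_ ij].
by rewrite ltn_eqF// trial_weightT.
Qed.

Lemma independent_trials :
  mutually_independent (P := unit_prob) (trials : nat -> {RV unit_prob >-> R}).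
Proof.
move=> J A HJ; pose n := \max_(j <- J) j.
have Jn j : j \in J -> (j <= n)%N by move=> jJ; exact: leq_bigmax_seq.
(* Indices outside [J] get the full set, of weight 1; the shift by one matches the [j.-1] iterations
   in [trials j]. *)
pose B i : set R := if i.+1 \in J then A i.+1 else setT.
have [|_] := @unit_prob_trials n B.
  move=> i; rewrite /B; case: ifPn => [iJ|_]; last exact: measurableT.
  by case: (HJ _ iJ).
rewrite [X in unit_prob X = _ -> _](_ : _ =
    \bigcap_(j in [set` J]) (trials j @^-1` A j)); last first.
  apply/seteqP; split => x /=.
    move=> H j /= jJ; have [j1 _] := HJ _ jJ.
    have := H j.-1; rewrite /B prednK// jJ; apply; exact: Jn.
  move=> H i iN; rewrite /B; case: ifPn => // iJ.
  exact: H.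
move=> PB; apply: (etrans PB); rewrite -prodEFin.
transitivity (\prod_(1 <= j < n.+1 | j \in J) (trial_weight (A j))%:E)%E.
  rewrite big_add1/= [RHS]big_mkcond/=; apply: eq_bigr => i _.
  by rewrite /B; case: ifPn => // _; rewrite trial_weightT.
rewrite -big_filter (perm_big (J : seq nat))/=; last first.
  apply: uniq_perm; [exact/filter_uniq/iota_uniq|exact: fset_uniq|].
  move=> j; rewrite mem_filter mem_index_iota; have [jJ/=|//] := boolP (j \in J).
  by have [-> _] := HJ _ jJ; rewrite ltnS Jn.
rewrite big_seq [RHS]big_seq; apply: eq_bigr => j jJ; have [j1 mAj] := HJ _ jJ.
by rewrite (distribution_trials j1 mAj).
Qed.

Lemma trials01 (j : nat) (x : TR) : trials j x = 0 \/ trials j x = 1.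
Proof. by rewrite /trials /trial indicE; case: (_ \in _); [right|left]. Qed.

Lemma iid_trials : iid01 (P := unit_prob) (trials : nat -> {RV unit_prob >-> R}).
Proof.
split; first exact: independent_trials.
  move=> i A i1 mA; transitivity (trial_weight A)%:E; first exact: distribution_trials.
  by apply/esym/distribution_trials.
by apply: aeW => w; case: (trials01 1 w) => /= ->; rewrite ?lexx ?ler01.
Qed.

Lemma expect_trials : \int[unit_prob]_x trials 1 x = p.
Proof.
apply: EFin_inj; rewrite expect_indic; last exact: measurable_success.
transitivity (unit_prob (success `&` shift @^-1` setT)).
  by rewrite preimage_setT setIT.
rewrite unit_prob_success; last exact: measurableT.
by rewrite unit_prob_setT mule1.
Qed.

End bernoulli_sequence.

(** * Lower bound on the regret for sequences with values 0 and 1 *)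

Section two_point_sequence.
Context d (T : measurableType d) (R : realType) (P : probability T R).
Variables (X : nat -> {RV P >-> R}) (p c : R) (n : nat).
Hypotheses (iidX : iid01 X) (X01 : forall j w, X j w = 0 \/ X j w = 1).
Hypotheses (EX : \int[P]_w X 1%N w = p) (n1 : (1 <= n)%N).

Let mX j : measurable_fun setT (X j). Proof. exact: measurable_funP. Qed.

Let clipX j w : clip (X j w) = X j w.
Proof. by apply: clip_id; case: (X01 j w) => ->; rewrite lexx ler01. Qed.

Let bX j : bmfun (X j).
Proof.
by split => //; exists 1 => w; case: (X01 j w) => ->; rewrite ?normr0 ?normr1.
Qed.

Let Eclip : \int[P]_w clip (X 1%N w) = p.
Proof. by rewrite -EX; apply: eq_Rintegral => w _; rewrite clipX. Qed.

(** The history as a finite word, of which membership in an event of the natural filtration is a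
    function. *)
Definition outcomes (i k : nat) (w : T) : seq bool :=
  [seq X j w == 1 | j <- iota i k].

Let outcomesS i k (g : seq bool -> bool) w :
  (g (outcomes i k.+1 w))%:R =
  X i w * (g (true :: outcomes i.+1 k w))%:R +
  (1 - X i w) * (g (false :: outcomes i.+1 k w))%:R :> R.
Proof.
rewrite /outcomes /=; case: (X01 i w) => ->.
  by rewrite eq_sym oner_eq0 mul0r add0r subr0 mul1r.
by rewrite eqxx subrr mul0r addr0 mul1r.
Qed.

Lemma bmfun_outcomes i k (g : seq bool -> bool) :
  bmfun (fun w => (g (outcomes i k w))%:R : R).
Proof.
elim: k i g => [|k IH] i g; first exact: (bmfun_cst _ (g [::])%:R).
under eq_fun do rewrite outcomesS; apply: bmfunD; apply: bmfunM => //.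
- exact: (IH i.+1 (fun s => g (true :: s))).
- by apply: bmfunB => //; exact: bmfun_cst.
- exact: (IH i.+1 (fun s => g (false :: s))).
Qed.

Let unitfun_cst1 : unitfun (fun _ : R => 1 : R).
Proof. by split => [|x]; [exact: measurable_cst|rewrite ler01 lexx]. Qed.

(** The next variable is independent of the history. The induction moves outcomes one at a time from
    the word into the product, as factors [X] or [1 - X], until [expect_prod] applies. *)
Let expect_next (i k : nat) (u : nat -> R -> R) (g : seq bool -> bool) :
  (forall j, unitfun (u j)) ->
  \int[P]_w (((\prod_(1 <= j < i.+1) u j (X j w)) *
              (g (outcomes i.+1 k w))%:R) * X (i + k).+1 w) =
  p * \int[P]_w ((\prod_(1 <= j < i.+1) u j (X j w)) *
                 (g (outcomes i.+1 k w))%:R).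
Proof.
have bu (v : nat -> R -> R) m : (forall j, unitfun (v j)) ->
    bmfun (fun w => \prod_(1 <= j < m) v j (X j w)).
  by move=> uv; apply: bmfun_prod => j; exact: unitfun_bmfun.
case: iidX => indX idX _.
elim: k i u g => [|k IH] i u g uu.
  pose A w := \prod_(1 <= j < i.+1) u j (X j w).
  have bA : bmfun A by exact: bu.
  have EA : \int[P]_w (A w * X i.+1 w) = p * \int[P]_w A w.
    pose v j : R -> R := if j == i.+1 then @clip R else u j.
    have vi : v i.+1 = @clip R by rewrite /v eqxx.
    have vj j : (j < i.+1)%N -> v j = u j by move=> ji; rewrite /v ltn_eqF.
    have uv j : unitfun (v j) by rewrite /v; case: ifP => // _; exact: unitfun_clip.
    transitivity (\int[P]_w (\prod_(1 <= j < i.+2) v j (X j w))).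
      apply: eq_Rintegral => w _; rewrite big_nat_recr//= vi clipX; congr (_ * _).
      by apply: eq_big_nat => j /andP[_ ji]; rewrite vj.
    rewrite (expect_prod indX idX)// big_nat_recr//= vi Eclip mulrC; congr (_ * _).
    rewrite /A (expect_prod indX idX)//.
    by apply: eq_big_nat => j /andP[_ ji]; rewrite vj.
  pose r : R := (g [::])%:R.
  transitivity (\int[P]_w (r * (A w * X i.+1 w))).
    by apply: eq_Rintegral => w _; rewrite addn0 -/(A w) /outcomes/= -/r mulrAC mulrC.
  transitivity (p * \int[P]_w (r * A w)).
    by rewrite !expectZ ?EA//; [exact: mulrCA|exact: bmfunM].
  congr (_ * _).
  by apply: eq_Rintegral => w _; rewrite -/(A w) /outcomes/= -/r mulrC.
pose v (b : bool) j : R -> R :=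
  if j == i.+1 then (if b then @clip R else fun x => 1 - clip x) else u j.
have uv b j : unitfun (v b j).
  rewrite /v; case: ifP => // _; case: b; first exact: unitfun_clip.
  exact/unitfun_onem/unitfun_clip.
have split_w w : \prod_(1 <= j < i.+1) u j (X j w) * (g (outcomes i.+1 k.+1 w))%:R =
    \prod_(1 <= j < i.+2) v true j (X j w) * (g (true :: outcomes i.+2 k w))%:R +
    \prod_(1 <= j < i.+2) v false j (X j w) * (g (false :: outcomes i.+2 k w))%:R.
  rewrite outcomesS mulrDr !mulrA.
  congr (_ * _ + _ * _); rewrite [RHS]big_nat_recr//= {2}/v eqxx clipX;
    congr (_ * _); apply: eq_big_nat => j /andP[_ ji]; by rewrite /v ltn_eqF.
have bv b : bmfun (fun w => \prod_(1 <= j < i.+2) v b j (X j w) *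
    (g (b :: outcomes i.+2 k w))%:R).
  apply: bmfunM; first exact: bu.
  exact: (bmfun_outcomes _ _ (fun s => g (b :: s))).
under eq_Rintegral do rewrite split_w mulrDl addnS -addSn.
under [in RHS]eq_Rintegral do rewrite split_w.
rewrite !expectD//; [|exact: bmfunM|exact: bmfunM].
rewrite (IH i.+1 (v true) (fun s => g (true :: s)))//.
by rewrite (IH i.+1 (v false) (fun s => g (false :: s)))// -mulrDr.
Qed.

(** The sets stable under equality of histories form a sigma-algebra containing the generators. *)
Lemma natural_filtration_outcomes (k : nat) (A : set T) :
  natural_filtration (net_return X c) k A ->
  forall w w', outcomes 1 k w = outcomes 1 k w' -> A w -> A w'.
Proof.
pose Inv : set (set T) :=
  [set A | forall w w', outcomes 1 k w = outcomes 1 k w' -> A w -> A w'].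
suff : natural_filtration (net_return X c) k `<=` Inv by move=> /[apply].
apply: smallest_sub.
  split=> [//|B HB w w' ww' [_ Bw]|F HF w w' ww' [i _ Fw]].
    by split => // Bw'; apply: Bw; exact: HB (esym ww') Bw'.
  by exists i => //; exact: HF ww' Fw.
have sub (s : seq 'I_k) : \big[setU/set0]_(i <- s)
    preimage_set_system setT (net_return X c i.+1) measurable `<=` Inv.
  elim: s => [|i s IH]; first by rewrite big_nil.
  rewrite big_cons => B [|/IH//] [C _ <-] w w' ww' [_ CX]; split => //.
  suff E : net_return X c i.+1 w = net_return X c i.+1 w'.
    by move: CX; rewrite /preimage/= E.
  rewrite /net_return; congr (_ - _).
  have := congr1 (fun s => nth false s i) ww'.
  rewrite !(nth_map 0%N) ?size_iota// !nth_iota// add1n.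
  case: (X01 i.+1 w) => ->; case: (X01 i.+1 w') => -> //.
    by rewrite eqxx eq_sym oner_eq0.
  by rewrite eqxx eq_sym oner_eq0.
exact: sub.
Qed.

Lemma statistician_value_le : p <= c ->
  (statistician_value P (net_return X c) n <= (p - c)%:E)%E.
Proof.
move=> pc; apply: ge_ereal_sup => _ [tau [tau_n tauF] <-].
pose e i w : R := (i <= tau w)%:R.
(* Tells from the word [s] alone that the rule has not stopped by time [k]; all points with the same
   history agree on this. *)
pose g k (s : seq bool) : bool :=
  ~~ `[< exists w, (tau w <= k)%N /\ outcomes 1 k w = s >].
have eE k w : (1 <= k <= n)%N -> e k.+1 w = (g k (outcomes 1 k w))%:R.
  move=> kn; rewrite /e ltnNge /g; congr (~~ _)%:R.
  apply/idP/asboolP => [tk|[w' [tk ww']]]; first by exists w.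
  exact: (natural_filtration_outcomes (tauF k kn) ww' tk).
have e1 w : e 1%N w = 1 by rewrite /e; case/andP: (tau_n w) => ->.
have be i : bmfun (e i).
  case: i => [|[|k]].
  - by rewrite (_ : e 0%N = fun _ => 1); [exact: bmfun_cst|apply/funext].
  - by rewrite (_ : e 1%N = fun _ => 1); [exact: bmfun_cst|apply/funext].
  have [kn|kn] := leqP k.+1 n.
    rewrite (_ : e k.+2 = fun w => (g k.+1 (outcomes 1 k.+1 w))%:R).
      exact: bmfun_outcomes.
    by apply/funext => w; rewrite eE.
  rewrite (_ : e k.+2 = fun _ => 0); first exact: bmfun_cst.
  apply/funext => w; rewrite /e; case/andP: (tau_n w) => _ tn.
  by rewrite leqNgt ltnS (leq_trans tn)// ltnW// ltnW.
have Ee i : (1 <= i <= n)%N -> \int[P]_w (e i w * (X i w - c)) =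
    (p - c) * \int[P]_w e i w.
  move=> iN.
  have H : \int[P]_w (e i w * X i w) = p * \int[P]_w e i w.
    case: i iN => [//|[|k]] kn.
      rewrite (_ : e 1%N = fun _ => 1); last exact/funext.
      by rewrite expect_cst mulr1 -EX; apply: eq_Rintegral => w _; rewrite mul1r.
    have kn' : (1 <= k.+1 <= n)%N by case/andP: kn => _ /ltnW.
    have := @expect_next 0 k.+1 (fun _ _ => 1) (g k.+1) (fun _ => unitfun_cst1).
    have -> : (fun w => \prod_(1 <= j < 1) (1 : R) * (g k.+1 (outcomes 1 k.+1 w))%:R) =
        e k.+2.
      by apply/funext => w; rewrite big_geq// mul1r eE.
    under eq_Rintegral do rewrite big_geq// mul1r -eE//.
    by [].
  rewrite mulrBl -H -expectZ// -expectB; [|exact: bmfunM|exact: bmfunZ].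
  by apply: eq_Rintegral => w _; rewrite mulrBr [c * _]mulrC.
pose D w := \sum_(1 <= i < n.+1) e i w * (X i w - c).
have bXc i : bmfun (fun w => X i w - c) by apply: bmfunB => //; exact: bmfun_cst.
have bD : bmfun D by apply: bmfun_sum => i; exact: bmfunM.
have bY i : bmfun (net_return X c i) by apply: bmfunB => //; exact: bmfun_cst.
(* The difference [e i - e i.+1] indicates stopping at [i], so the stopped return is a finite sum of
   bounded measurable functions. *)
have YE w : net_return X c (tau w) w =
    \sum_(1 <= i < n.+1) (e i w - e i.+1 w) * net_return X c i w.
  rewrite (bigD1_seq (tau w)) ?iota_uniq//=; last by rewrite mem_index_iota ltnS.
  rewrite big1 ?addr0; last first.
    move=> i it; rewrite /e [(i <= _)%N]leq_eqVlt (negbTE it)/=.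
    by rewrite subrr mul0r.
  by rewrite /e leqnn ltnn subr0 mul1r.
have bYt : bmfun (fun w => net_return X c (tau w) w).
  rewrite (_ : (fun w => _) = fun w =>
    \sum_(1 <= i < n.+1) (e i w - e i.+1 w) * net_return X c i w); last exact/funext.
  by apply: bmfun_sum => i; apply: bmfunM => //; exact: bmfunB.
rewrite expectationE// lee_fin; apply: (@le_trans _ _ (\int[P]_w D w)).
  apply: expect_le => // w; rewrite /D /net_return.
  have /andP[t1 tn] := tau_n w.
  rewrite (big_cat_nat (n := (tau w).+1))//=.
  rewrite [X in _ <= _ + X]big1_seq ?addr0; last first.
    move=> i; rewrite mem_index_iota => /andP[_ /andP[ti _]].
    by rewrite /e leqNgt ti mul0r.
  have -> : \sum_(1 <= i < (tau w).+1) e i w * (X i w - c) =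
      \sum_(1 <= i < (tau w).+1) X i w - (tau w)%:R * c.
    rewrite (_ : (tau w)%:R * c = \sum_(1 <= i < (tau w).+1) c); last first.
      by rewrite sumr_const_nat subn1 mulr_natl.
    rewrite -sumrB.
    by apply: eq_big_nat => i /andP[_ it]; rewrite /e -ltnS it mul1r.
  rewrite lerD2r big_nat_recr//= lerDr sumr_ge0// => i _.
  by case: (X01 i w) => ->; rewrite ?lexx ?ler01.
rewrite expect_sum; last by move=> i; exact: bmfunM.
(* The first observation is always made and contributes [p - c]; the later ones contribute multiples
   of [p - c], hence at most 0. *)
rewrite big_ltn ?ltnS// Ee ?n1//.
rewrite (_ : e 1%N = fun _ => 1); last exact/funext.
rewrite expect_cst mulr1 gerDl big_nat sumr_le0// => i /andP[i1 iN].
rewrite Ee; last by rewrite ltnW.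
rewrite mulr_le0_ge0 ?subr_le0//; apply: Rintegral_ge0 => w _.
by rewrite /e.
Qed.

(** The prophet may take the first success; without any success the first return is still at least
    [- c]. *)
Lemma prophet_value_ge :
  ((- c + \sum_(1 <= i < n.+1) p * (1 - p) ^+ i.-1 * (1 - i.-1%:R * c))%:E <=
   prophet_value P (net_return X c) n)%E.
Proof.
pose b i : R := 1 - i.-1%:R * c.
have bY i : bmfun (net_return X c i) by apply: bmfunB => //; exact: bmfun_cst.
have bb i : bmfun (fun w => X i w * b i) by apply: bmfunM => //; exact: bmfun_cst.
pose S w := stop_mix (fun i => X i w) (fun i => X i w * b i) 1 n.
have bS : bmfun S.
  exact: (bmfun_stop_mix (g := fun i w => X i w) (r := fun i w => X i w * b i)).
rewrite /prophet_value expectationE; last exact: bmfun_bigmax.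
rewrite lee_fin -stop_mix_cst.
have -> : stop_mix (fun _ => p) (fun i => p * b i) 1 n = \int[P]_w S w.
  have uc := @unitfun_clip R.
  have := @expect_stop_mix _ _ _ _ _ iidX (fun _ => @clip R) (fun _ => @clip R)
    (fun _ => @clip R) b (fun _ => 0) n (fun _ => uc) (fun _ => uc) (fun _ => uc).
  rewrite Eclip => H.
  transitivity (stop_mix (fun _ => p) (fun i => b i * p + 0 * p) 1 n).
    by congr stop_mix; apply/funext => i; rewrite mul0r addr0 mulrC.
  rewrite -H; apply: eq_Rintegral => w _.
  rewrite /S; congr stop_mix; apply/funext => i; rewrite ?clipX//.
  by rewrite mul0r addr0 mulrC.
rewrite -[X in X + _](expect_cst P) -expectD//; last exact: bmfun_cst.
apply: expect_le.
- by apply: bmfunD => //; exact: bmfun_cst.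
- exact: bmfun_bigmax.
move=> w; pose a i := X i w == 1.
have aE i : X i w = (a i)%:R.
  by rewrite /a; case: (X01 i w) => ->; rewrite ?eqxx// eq_sym oner_eq0.
have SE : S w = stop_mix (fun i => (a i)%:R) (fun i => (a i)%:R * b i) 1 n.
  by rewrite /S; congr stop_mix; apply/funext => i; rewrite aE.
have [ha|ha] := boolP (has a (iota 1 n)).
  rewrite SE (stop_mix_find b ha); set f := (1 + _)%N.
  have fn : f \in index_iota 1 n.+1.
    by rewrite mem_index_iota /f add1n !ltnS -[X in (_ < X)%N](size_iota 1 n) -has_find.
  apply: le_trans (@le_bigmax_seq _ R _ _ _ f xpredT _ fn isT).
  rewrite /net_return aE /b /f add1n /=.
  have -> : a (find a (iota 1 n)).+1 = true.
    have := nth_find 0%N ha; rewrite nth_iota ?add1n//.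
    by rewrite -[X in (_ < X)%N](size_iota 1 n) -has_find.
  by rewrite (_ : true%:R = 1 :> R)// -natr1; lra.
have -> : S w = 0.
  rewrite SE stop_mixE big1_seq// => i; rewrite mem_index_iota add1n ltnS => iN.
  have := hasPn ha i; rewrite mem_iota add1n ltnS => /(_ iN) /negbTE ->.
  by rewrite mul0r mulr0.
rewrite addr0; apply: le_trans (bigmax_ge_id _ _ _ _).
rewrite /net_return mul1r lerBrDr addrC subrr.
by case: (X01 1%N w) => ->; rewrite ?lexx ?ler01.
Qed.

End two_point_sequence.

(** The term of the first observation is [p], so [- c + p] cancels against the statistician's
    [p - c]. *)
Lemma regret_bound_ge (R : realType) (p c b : R) (n : nat) : 0 < p < 1 ->
  p <= c -> (1 <= n)%N -> regret_bound c n b ->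
  \sum_(1 <= j < n) p * (1 - p) ^+ j * (1 - j%:R * c) <= b.
Proof.
move=> p01 pc n1 /(_ _ _ _ _ (iid_trials p01)) H.
have X01 := trials01 p; have EX := expect_trials p01.
have iidX := iid_trials p01.
have V := statistician_value_le iidX X01 EX n1 pc.
have M := @prophet_value_ge _ _ _ _ _ p c n iidX X01 EX.
rewrite -lee_fin; apply: le_trans H.
rewrite /regret; apply: le_trans (leeB M V).
rewrite -EFinB lee_fin [\sum_(1 <= i < n.+1) _]big_ltn ?ltnS// expr0 mulr1 mul0r subr0 mulr1.
by rewrite big_add1/=; lra.
Qed.

(** * The theorem *)

Lemma strict_floor_invP (R : realType) (c : R) : 0 < c <= 1 ->
  exists K : nat, [/\ strict_floor (1 / c) = K%:Z, K%:R * c < 1 & 1 <= K.+1%:R * c].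
Proof.
move=> /andP[c0 c1].
have lt := strict_floor_lt (1 / c).
have ge0 : 0 <= strict_floor (1 / c).
  by apply: strict_floor_max; rewrite divr_gt0.
have ub : 1 / c <= (strict_floor (1 / c) + 1)%:~R.
  by rewrite /strict_floor subrK ceil_ge.
move: lt ub; case: (strict_floor (1 / c)) ge0 => // K _ lt ub.
exists K; split => //; first by rewrite -ltr_pdivlMr.
rewrite -ler_pdivrMr//; apply: le_trans ub _.
by rewrite -(PoszD K 1) addn1.
Qed.

Lemma regret_le_prophet_const (R : realType) d (T : measurableType d)
    (P : probability T R) (X : nat -> {RV P >-> R}) (c : R) (n : nat) :
  iid01 X -> 0 <= c -> (1 <= n)%N -> (regret X c n <= (prophet_const R n.-1)%:E)%E.
Proof.
move=> iidX c0 n1.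
have [[N Nn [p /andP[cp p1] H]]|[p [/andP[p0 p1] pc] H]] := regret_le iidX c0 n1.
  apply: (le_trans H); rewrite lee_fin.
  apply: (@le_trans _ _ (prophet_const R N)).
    by apply: geo_peak_le; rewrite p1 (le_trans c0).
  by apply: prophet_const_homo; rewrite -ltnS prednK.
apply: (le_trans H); rewrite lee_fin.
(* As [p <= c], lowering the cost to [p] only raises the sum; the estimate is then used at level 0
   and cost [p]. *)
have [||N Nn HN] := @truncated_geo_sum_le R p 0 p n.-1 _ p1.
- by rewrite p0 lexx.
- by rewrite subrr mul0r mulr0.
rewrite prednK// in HN.
apply: (@le_trans _ _ (prophet_const R N)); last exact: prophet_const_homo.
apply: (le_trans _ (le_trans HN (geo_peak_le _ _))); last by rewrite p0 p1.
apply: ler_sum_nat => j _; apply: ler_wpM2l.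
  by rewrite mulr_ge0// exprn_ge0// subr_ge0.
rewrite subr0 ge_max le_max lexx/= le_max; apply/orP; right.
by rewrite lerD2l lerN2 ler_wpM2l.
Qed.

(** Extremal case: success probability and cost both equal to the peak [1 / (n + 1)], where the sum
    telescopes. *)
Lemma regret_bound_prophet_const (R : realType) (b : R) (n : nat) : (1 <= n)%N ->
  regret_bound (n.+1%:R^-1) n b -> prophet_const R n.-1 <= b.
Proof.
move=> n1 H; have pV : 0 < (n.+1%:R^-1 : R) < 1.
  by rewrite invr_gt0 ltr0n invf_lt1 ?ltr0n// ltr1n.
apply: le_trans (regret_bound_ge pV (lexx _) n1 H).
case: n n1 {H} pV => // n _ pV.
under eq_bigr do rewrite -mulrA.
by rewrite -big_distrr/= sum_geo_weight /prophet_const mulrCA mulrA.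
Qed.

Theorem mainTheorem1 (R : realType) :
  (forall c : R, 0 < c <= 1 ->
     (c <= 1 / 2 ->
        let B := (strict_floor (1 / c))%:~R * c
                 * (1 - c) ^ (strict_floor (1 / c) + 1) in
        (forall n : nat, (1 <= n)%N -> regret_bound c n B) /\
        (forall b : R,
           (forall n : nat, (1 <= n)%N -> regret_bound c n b) -> B <= b)) /\
     (1 / 2 <= c ->
        let B := (1 - c) / 4 in
        (forall n : nat, (1 <= n)%N -> regret_bound c n B) /\
        (forall b : R,
           (forall n : nat, (1 <= n)%N -> regret_bound c n b) -> B <= b)))
  /\
  (forall n : nat, (1 <= n)%N ->
     let B : R := (n%:R - 1) * (1 - 1 / (n%:R + 1)) ^+ n / (n%:R + 1) in
     (forall c : R, 0 <= c -> regret_bound c n B) /\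
     (forall b : R,
        (forall c : R, 0 <= c -> regret_bound c n b) -> B <= b))
  /\
  ((forall (c : R) (n : nat), 0 <= c -> (1 <= n)%N ->
      forall (d : measure_display) (T : measurableType d)
        (P : probability T R) (X : nat -> {RV P >-> R}),
        iid01 X -> (regret X c n < (expR (-1))%:E)%E) /\
   (forall b : R,
      (forall (c : R) (n : nat), 0 <= c -> (1 <= n)%N -> regret_bound c n b) ->
      expR (-1) <= b)).
Proof.
split; last split.
- move=> c c01; have /andP[c0 c1] := c01; split => [c12|c12] B.
    have [K [KE Kc KSc]] := strict_floor_invP c01.
    have BE : B = K%:R * c * (1 - c) ^+ K.+1.
      rewrite /B KE; congr (_ * _).
      by rewrite -(PoszD K 1) addn1.
    split.
      move=> n n1 d T P X iidX; rewrite BE.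
      have [[N Nn [p cp H]]|[p [p01 pc] H]] := regret_le iidX (ltW c0) n1.
        apply: (le_trans H); rewrite lee_fin.
        by apply: geo_peak_le_cost => //; exact: ltW.
      apply: (le_trans H); rewrite lee_fin.
      (* Keep the terms with [j * c <= 1], raise [p] to [c], and then replace [N] by the optimal
         [K]. *)
      have [N [_ Nc] NE] := @max0_sum_trunc R p c n.-1 (ltW c0).
      rewrite prednK// in NE; rewrite NE.
      have p0c : 0 <= p <= c by rewrite pc andbT; case/andP: p01.
      apply: (le_trans (truncated_sum_mono p0c c12 Nc)).
      rewrite mulrAC [leRHS]mulrAC ler_wpM2r ?(ltW c0)//.
      by apply: linear_geo_le => //; exact: ltW.
    move=> b H; have cl1 : 0 < c < 1 by rewrite c0/=; lra.
    (* Attained at horizon [K + 1] by success probability [c]. *)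
    apply: le_trans (regret_bound_ge cl1 (lexx c) (ltn0Sn K) (H _ (ltn0Sn K))).
    under eq_bigr do rewrite -mulrA.
    by rewrite -big_distrr/= sum_geo_weight BE mulrCA mulrA.
  split.
    move=> n n1 d T P X iidX.
    have [[N Nn [p cp H]]|[p [p01 pc] H]] := regret_le iidX (ltW c0) n1.
      by apply: (le_trans H); rewrite lee_fin half_cost_peak.
    apply: (le_trans H); rewrite lee_fin -(prednK n1).
    by apply: half_cost_sum => //; rewrite c12.
  (* Fair coins at horizon 2 attain the bound for every [c >= 1 / 2], since
     [p * (1 - p) = 1 / 4]. *)
  move=> b H; have p01 : 0 < (1 / 2 : R) < 1 by lra.
  have := regret_bound_ge p01 c12 (isT : (1 <= 2)%N) (H 2 isT).
  by rewrite big_nat1; apply: le_trans; rewrite /B; lra.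
- move=> n n1 B; have BE : B = prophet_const R n.-1 by rewrite prophet_constE.
  split=> [c c0 d T P X iidX|b H]; rewrite BE.
    exact: regret_le_prophet_const.
  by apply: regret_bound_prophet_const => //; apply: H; rewrite invr_ge0.
- split=> [c n c0 n1 d T P X iidX|b H].
    apply: le_lt_trans (regret_le_prophet_const iidX c0 n1) _.
    by rewrite lte_fin prophet_const_lt_expRN1.
  apply: expRN1_le_of_prophet_const => N.
  apply: (@regret_bound_prophet_const R b N.+1) => //.
  by apply: H => //; rewrite invr_ge0.
Qed.
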